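(* Let $n\ge4$ be an integer and let $(N_0^n,g_{N_0})$ be the Riemannian Schwarzschild–Tangherlini manifold, with functions $\varphi,\psi$ as defined in the context. The map $f_{N_0}\colon N_0^n\to\mathbb{R}^{n+2}$ given in polar coordinates by $$f_{N_0}(t,\theta,y)=\bigl(\psi(t),\ \varphi'(t)\cos\theta,\ \varphi'(t)\sin\theta,\ \varphi(t)\,y\bigr)\in\mathbb{R}\times\mathbb{R}\times\mathbb{R}\times\mathbb{R}^{n-1},\qquad y\in\mathbb{S}^{n-2}\subset\mathbb{R}^{n-1},$$ and extended smoothly across $t=0$, is an isometric embedding onto a submanifold of $\mathbb{R}^{n+2}$, and its codimension two is the smallest possible, i.e. $N_0^n$ admits no isometric embedding into $\mathbb{R}^{n}$ or $\mathbb{R}^{n+1}$.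
   Context: Riemannian Schwarzschild–Tangherlini manifold: fix $n\ge4$ and set $\mu=\frac{n-3}{2}$. Let $\varphi\in C^\infty([0,\infty))$ be the unique nonconstant solution of $$\varphi'^2=1-\left(\frac{\mu}{\varphi}\right)^{n-3},\qquad \varphi(0)=\mu,\quad \varphi'(0)=0,$$ characterized by $\varphi'(t)>0$ for every $t>0$; equivalently, $\varphi$ solves $\varphi''=\frac{n-3}{2}\frac{\mu^{n-3}}{\varphi^{n-2}}$, $\varphi(0)=\mu$, $\varphi'(0)=0$. It extends to a smooth even function on $\mathbb{R}$ with $\varphi''(0)=1$. Let $L_0^2\cong\mathbb{R}^2$ with origin $o$ and polar coordinates $(t,\theta)$, $t\ge0$, $\theta\in[0,2\pi)$, with the metric $g_{L_0}=dt^2+\varphi'(t)^2\,d\theta^2$ on $L_0^2\setminus\{o\}$, which extends smoothly across $o$. Then $$N_0^n=L_0^2\times_\varphi\mathbb{S}^{n-2},\qquad g_{N_0}=dt^2+\varphi'(t)^2\,d\theta^2+\varphi(t)^2 g_{\mathbb{S}^{n-2}},$$ where $g_{\mathbb{S}^{n-2}}$ is the unit round metric and the metric is extended smoothly across $\{o\}\times\mathbb{S}^{n-2}$. The function $\psi$: set $Q:=1-\varphi'^2-\varphi''^2=(\mu/\varphi)^{n-3}-(\mu/\varphi)^{2n-4}$, which is even, vanishes at $t=0$ with $Q''(0)>0$, and is positive for $t>0$. Its positive square root on $t>0$ extends to a smooth odd function $\eta$ across $0$, and $\psi(t)=\int_0^t\eta(s)\,ds$. Thus $\psi$ is smooth and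 even, $\psi(0)=0$, $\psi'>0$ on $(0,\infty)$ and $\psi'^2=1-\varphi'^2-\varphi''^2$. At $t=0$ the map is $f_{N_0}(o,y)=(0,0,0,\mu y)$. *)

(* Defs.v *)
From mathcomp Require Import all_boot all_order all_algebra.
From mathcomp Require Import all_classical all_reals all_analysis.
From mathcomp Require Import ring.

Set Implicit Arguments.
Unset Strict Implicit.
Unset Printing Implicit Defensive.

Import Order.TTheory GRing.Theory Num.Theory.
Import numFieldNormedType.Exports.

Local Open Scope ring_scope.
Local Open Scope classical_set_scope.

(* The norm of the normed module 'rV[R]_m is the sup norm; it is used here only
   through the topology and the differentials it induces.  Euclidean geometry
   goes through [dot] and [enorm]. *)
Definition dot (R : realType) (m : nat) (u v : 'rV[R]_m) : R :=
  \sum_i u ord0 i * v ord0 i.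

Definition enorm (R : realType) (m : nat) (u : 'rV[R]_m) : R :=
  Num.sqrt (dot u u).

(* Meant for U open and V, W finite-dimensional; there the continuity of all
   directional derivatives is the continuity of the differential. *)
Fixpoint Ck (R : realType) (V W : normedModType R) (k : nat) (U : set V)
    (f : V -> W) : Prop :=
  match k with
  | 0%N => forall x, U x -> {for x, continuous f}
  | k'.+1 => (forall x, U x -> differentiable f x) /\
             (forall v, Ck k' U (fun x => 'D_v f x))
  end.

Definition Cinfty (R : realType) (V W : normedModType R) (U : set V)
  (f : V -> W) : Prop := forall k, Ck k U f.

(* A submanifold M of V carries the induced smooth structure: f : M -> W is
   smooth when it extends, near each point of M, to a smooth map G on an open
   set of V, and its differential at p is then the restriction of 'd G p to the
   tangent space of M at p, for any such G.  Maps on M are given as total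
   functions on V whose values off M are irrelevant. *)
Definition local_extension (R : realType) (V W : normedModType R) (M : set V)
    (f : V -> W) (p : V) (U : set V) (G : V -> W) : Prop :=
  [/\ open U, U p, Cinfty U G & forall q, M q -> U q -> G q = f q].

Definition smooth_on (R : realType) (V W : normedModType R) (M : set V)
    (f : V -> W) : Prop :=
  forall p, M p -> exists U G, local_extension M f p U G.

Definition immersion_on (R : realType) (V W : normedModType R) (M : set V)
    (TM : V -> set V) (f : V -> W) : Prop :=
  forall p U G, M p -> local_extension M f p U G ->
  forall w, TM p w -> 'd G p w = 0 -> w = 0.

Definition smooth_embedding (R : realType) (V W : normedModType R) (M : set V)
    (TM : V -> set V) (f : V -> W) : Prop :=
  [/\ smooth_on M f,
      immersion_on M TM f &
      exists k : W -> V,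
        (forall p, M p -> k (f p) = p) /\ {within f @` M, continuous k}].

Definition isometric_on (R : realType) (V : normedModType R) (m : nat)
    (M : set V) (TM : V -> set V) (g : V -> V -> V -> R) (f : V -> 'rV[R]_m) :
    Prop :=
  forall p U G, M p -> local_extension M f p U G ->
  forall w w', TM p w -> TM p w' -> dot ('d G p w) ('d G p w') = g p w w'.

Definition isometric_embedding (R : realType) (V : normedModType R) (m : nat)
    (M : set V) (TM : V -> set V) (g : V -> V -> V -> R) (f : V -> 'rV[R]_m) :
    Prop :=
  smooth_embedding M TM f /\ isometric_on M TM g f.

(* Embedded d-dimensional submanifolds of R^m, by local parametrizations. *)
Definition submanifold (R : realType) (m d : nat) (S : set 'rV[R]_m) : Prop :=
  forall p, S p ->
  exists (U : set 'rV[R]_m) (D : set 'rV[R]_d) (h : 'rV[R]_d -> 'rV[R]_m)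
    (k : 'rV[R]_m -> 'rV[R]_d),
    [/\ open U /\ U p,
        open D /\ h @` D = S `&` U,
        Cinfty D h,
        forall x v, D x -> 'd h x v = 0 -> v = 0 &
        (forall x, D x -> k (h x) = x) /\ {within S `&` U, continuous k}].

Definition mass (R : realType) (n : nat) : R := (n%:R - 3) / 2.

(* phi is given on the whole line, as the smooth even extension of the solution
   on [0, +oo[, so that its derivatives at 0 are the two-sided ones. *)
Definition tangherlini_profile (R : realType) (n : nat) (phi : R -> R) : Prop :=
  [/\ forall k t, derivable (derive1n k phi) t 1,
      forall t, phi (- t) = phi t,
      phi 0 = mass R n /\ derive1 phi 0 = 0,
      forall t, 0 <= t -> derive1 phi t ^+ 2 = 1 - (mass R n / phi t) ^+ (n - 3) &
      forall t, 0 < t -> 0 < derive1 phi t].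

(* The smooth odd square root of Q, for t >= 0 (Q vanishes at 0). *)
Definition eta (R : realType) (phi : R -> R) (t : R) : R :=
  Num.sqrt (1 - derive1 phi t ^+ 2 - derive1n 2 phi t ^+ 2).

Definition psi (R : realType) (phi : R -> R) (t : R) : R :=
  \int[lebesgue_measure]_(s in `[0, t]) eta phi s.

(* N_0 = R^2 x S^(n-2), inside R^2 x R^(n-1). *)
Definition N0_ambient (R : realType) (n : nat) : normedModType R :=
  ('rV[R]_2 * 'rV[R]_(n.-1))%type.

Definition N0 (R : realType) (n : nat) : set (N0_ambient R n) :=
  [set p | dot p.2 p.2 = 1].

Definition N0_tangent (R : realType) (n : nat) (p : N0_ambient R n) :
    set (N0_ambient R n) :=
  [set w | dot p.2 w.2 = 0].

Definition vec2 (R : realType) (a b : R) : 'rV[R]_2 := \row_j [:: a; b]`_j.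

Definition polar (R : realType) (t theta : R) : 'rV[R]_2 :=
  vec2 (t * cos theta) (t * sin theta).

Definition dt (R : realType) (x u : 'rV[R]_2) : R := dot x u / enorm x.

Definition dtheta (R : realType) (x u : 'rV[R]_2) : R :=
  (x 0 0 * u 0 1 - x 0 1 * u 0 0) / enorm x ^+ 2.

(* dt^2 + phi'(t)^2 dtheta^2; since phi'(t) / t tends to phi''(0) = 1, its
   extension to the origin is the Euclidean product. *)
Definition gL0 (R : realType) (phi : R -> R) (x u u' : 'rV[R]_2) : R :=
  if x == 0 then dot u u'
  else dt x u * dt x u' +
       derive1 phi (enorm x) ^+ 2 * (dtheta x u * dtheta x u').

Definition gN0 (R : realType) (n : nat) (phi : R -> R)
    (p w w' : N0_ambient R n) : R :=
  gL0 phi p.1 w.1 w'.1 + phi (enorm p.1) ^+ 2 * dot w.2 w'.2.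

(* The point (cos theta, sin theta) is p.1 / t.  At t = 0 the division returns
   0, in accordance with phi'(0) = 0.  The target is R^3 x R^(n-1) = R^(n+2). *)
Definition fN0 (R : realType) (n : nat) (phi : R -> R) (p : N0_ambient R n) :
    'rV[R]_(3 + n.-1) :=
  let t := enorm p.1 in
  row_mx (\row_j [:: psi phi t;
                     derive1 phi t * (p.1 0 0 / t);
                     derive1 phi t * (p.1 0 1 / t)]`_j)
         (phi t *: p.2).

Lemma dot_vec2 (R : realType) (a b c d : R) :
  dot (vec2 a b) (vec2 c d) = a * c + b * d.
Proof. by rewrite /dot !big_ord_recl big_ord0 addr0 !mxE. Qed.

Lemma enorm_polar (R : realType) (t theta : R) :
  0 <= t -> enorm (polar t theta) = t.
Proof.
move=> t0; rewrite /enorm dot_vec2 -!expr2 !exprMn -mulrDr cos2Dsin2 mulr1.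
by rewrite sqrtr_sqr ger0_norm.
Qed.

Lemma gL0_polar (R : realType) (phi : R -> R) (t theta a b a' b' : R) :
  0 < t ->
  let v a b := a *: vec2 (cos theta) (sin theta) +
               b *: vec2 (- t * sin theta) (t * cos theta) in
  gL0 phi (polar t theta) (v a b) (v a' b') =
  a * a' + derive1 phi t ^+ 2 * (b * b').
Proof.
move=> t0 v; have nt := enorm_polar theta (ltW t0).
have tn0 : t != 0 by rewrite gt_eqF.
have vE c d : v c d = vec2 (c * cos theta - d * (t * sin theta))
                           (c * sin theta + d * (t * cos theta)).
  apply/rowP => j; rewrite !mxE; case: j => -[|[|//]] ? /=; first ring.
  by [].
rewrite /gL0 ifF; last first.
  apply/eqP => p0; move: nt; rewrite p0 /enorm /dot big1 ?sqrtr0.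
    by move=> /esym/eqP; rewrite (negbTE tn0).
  by move=> i _; rewrite mxE mul0r.
have dtE c d : dt (polar t theta) (v c d) = c.
  rewrite /dt nt vE dot_vec2.
  rewrite (_ : _ + _ = t * c * (cos theta ^+ 2 + sin theta ^+ 2)); last ring.
  by rewrite cos2Dsin2 mulr1 mulrC mulKf.
have dthetaE c d : dtheta (polar t theta) (v c d) = d.
  rewrite /dtheta nt vE !mxE /=.
  rewrite (_ : _ - _ = t ^+ 2 * d * (cos theta ^+ 2 + sin theta ^+ 2)); last ring.
  by rewrite cos2Dsin2 mulr1 mulrC mulKf // expf_neq0.
by rewrite !dtE !dthetaE nt.
Qed.

Lemma fN0_polar (R : realType) (n : nat) (phi : R -> R) (t theta : R)
    (y : 'rV[R]_(n.-1)) :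
  tangherlini_profile n phi -> 0 <= t ->
  fN0 phi (polar t theta, y) =
  row_mx (\row_j [:: psi phi t; derive1 phi t * cos theta;
                     derive1 phi t * sin theta]`_j)
         (phi t *: y).
Proof.
move=> [_ _ [_ dphi0] _ _] t0; rewrite /fN0 /= enorm_polar //; congr row_mx.
have [->|tn0] := eqVneq t 0; first by rewrite dphi0 !mul0r.
by rewrite !mxE /= ![t * _]mulrC !mulfK.
Qed.

(* Main.v *)
From HB Require Import structures.
Require Import Defs.
From mathcomp Require Import all_boot all_order all_algebra.
From mathcomp Require Import all_classical all_reals all_analysis.
From mathcomp Require Import ring lra zify.

(* An even smooth function a of one variable gives a smooth function a(|x|):
   its gradient is (a'(t)/t)(|x|) x, and a'(t)/t is again even and smooth, by
   Taylor's formula.  With A(t) = phi'(t)/t the map reads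
   f(x, y) = (psi(|x|), A(|x|) x, phi(|x|) y), so it is smooth, and
   psi'^2 + phi'^2 + phi''^2 = 1 makes it isometric, hence an immersion.  Since
   phi' is strictly increasing, |x| is recovered continuously from |A(|x|) x|.

   For the codimension, two maps inducing the same metric have the same products
   <f_ij, f_k> and <f_ij, f_kl> - <f_il, f_jk>.  For the map above, at a point
   (o, y), f_ij is orthogonal to all f_k and equals delta_ij (y + psi''(0) nu)
   in two directions of L_0 (nu being the psi-axis), -mu delta_ij y in two
   directions of the sphere, and 0 in the mixed ones.  In codimension at most
   one, f_ij = h_ij N for a fixed vector N.  So the 2 x 2 minors of the 4 x 4
   matrix h are known up to the factor |N|^2, and expanding det h along two pairs
   of rows gives (1 + psi''(0)^2) mu^2 = mu^2, whereas psi''(0) <> 0. *)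

Set Implicit Arguments.
Unset Strict Implicit.
Unset Printing Implicit Defensive.

Import Order.TTheory GRing.Theory Num.Theory.
Import numFieldNormedType.Exports.
Local Open Scope ring_scope.
Local Open Scope classical_set_scope.

(** * Calculus of Ck functions *)

(** [Ck] lives on open sets, whereas [N0] is a closed subset of its ambient space. Composition with
    (x, y) -> (x, y / |y|) turns a map on [N0] into one on an open set, at the price of a pulled
    back form that degenerates along y. Second derivatives are therefore compared through the
    products <f_ij, f_k> in constant directions, by Koszul's identities, without inverting the form
    or introducing a connection. The other obstacle is psi, the integral of a square root whose
    argument vanishes at 0. With x = mu / phi, phi'^2 = 1 - x^(n-3) and Q = x^(n-3) (1 - x^(n-1))
    share the factor 1 - x, so psi' is phi' times a smooth positive function of x. Hence psi is a
    function of phi, and psi''(0) is the value of that factor at x = 1, namely sqrt((n-1)/(n-3)). *)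

Lemma near_eq_differentiable (R : realType) (V W : normedModType R)
    (f g : V -> W) (x : V) :
  (\forall y \near x, f y = g y) -> differentiable f x -> differentiable g x.
Proof.
move=> fg df; have fgx := nbhs_singleton fg.
(* ['d g x] is chosen among the continuous linear maps giving a first order expansion of [g], so it
   is enough to exhibit one, namely ['d f x]. *)
apply/diffP/(@getPex _ (fun dg : {linear V -> W} => continuous dg /\
  forall y, g y = g (lim (nbhs x)) + dg (y - lim (nbhs x))
                  +o_(y \near x) (y - lim (nbhs x)))).
exists ('d f x); split; first exact: diff_continuous.
have /diffP[_] := df; rewrite lim_id // => fE.
apply: eqaddoEx => y; move: y; apply/funeqP/eqaddoP => _ /posnumP[e].
have /eqaddoP/(_ _ (gt0 e)) : f = (fun y => f x + 'd f x (y - x))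
   +o_ (nbhs x) (fun y => y - x) by apply/funext => y; rewrite [LHS]fE.
apply: filterS2 fg => y fgy.
by rewrite !fctE fgy -fgx.
Qed.

Lemma derive_coord (R : realType) (V : normedModType R) n
    (f : V -> 'rV[R]_n) x v i : differentiable f x ->
  'D_v f x ord0 i = 'D_v (fun y => f y ord0 i) x.
Proof.
by move=> df; rewrite derive_mx ?mxE //; exact: diff_derivable.
Qed.

Lemma differentiable_rowP (R : realType) (V : normedModType R) n
    (f : V -> 'rV[R]_n) x :
  differentiable f x <-> forall i, differentiable (fun y => f y ord0 i) x.
Proof.
split=> [df i|df].
  exact: (@differentiable_comp _ _ _ _ f (fun N : 'rV[R]_n => N ord0 i) x df
    (differentiable_coord _ _ _)).
have -> : f = \sum_i (fun y => f y ord0 i *: delta_mx ord0 i).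
  apply/funext => y; rewrite {1}[f y]row_sum_delta fct_sumE //.
by apply: differentiable_sum => i; exact: differentiableZl.
Qed.

Lemma derive_diffE (R : realType) (V W : normedModType R) (f : V -> W) x v :
  differentiable f x -> 'd f x v = 'D_v f x.
Proof. by move=> df; rewrite deriveE. Qed.

(** Derivative formulas hold only on U, and the inductions on k replace ['D_v f] by its formula
    through this lemma. Openness turns agreement on U into agreement near each point, hence into
    equality of directional derivatives on U. *)
Lemma Ck_eq (R : realType) (V W : normedModType R) k (U : set V)
    (f g : V -> W) :
  open U -> (forall x, U x -> f x = g x) -> Ck k U f -> Ck k U g.
Proof.
move=> oU; elim: k f g => [|k IH] f g fg /=.
  move=> cf x Ux; have nfg : \forall y \near x, f y = g y.
    by apply: filterS (open_nbhs_nbhs (conj oU Ux)).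
  rewrite /prop_for /continuous_at -(fg _ Ux); apply: cvg_trans (cf x Ux).
  exact: near_eq_cvg.
move=> [df Df].
have nfg x (Ux : U x) : \forall y \near x, f y = g y.
  by apply: filterS (open_nbhs_nbhs (conj oU Ux)).
split=> [x Ux|v]; first exact: near_eq_differentiable (nfg x Ux) (df x Ux).
by apply: IH (Df v) => x Ux; apply: near_eq_derive; exact: nfg.
Qed.

Lemma Ck_continuous (R : realType) (V W : normedModType R) k (U : set V)
    (f : V -> W) : Ck k U f -> forall x, U x -> {for x, continuous f}.
Proof. by case: k => [//|k] [df _] x /df /differentiable_continuous. Qed.

Lemma CkS (R : realType) (V W : normedModType R) k (U : set V) (f : V -> W) :
  Ck k.+1 U f -> Ck k U f.
Proof.
elim: k f => [|k IH] f; first exact: Ck_continuous.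
by move=> [df Df]; split=> // v; exact: IH.
Qed.

Lemma sub_Ck (R : realType) (V W : normedModType R) k (U U' : set V)
    (f : V -> W) : U' `<=` U -> Ck k U f -> Ck k U' f.
Proof.
move=> sU; elim: k f => [|k IH] f; first by move=> cf x /sU /cf.
by move=> [df Df]; split=> [x /sU /df //|v]; exact: IH (Df v).
Qed.

Lemma Ck_cst (R : realType) (V W : normedModType R) k (U : set V) (a : W) :
  Ck k U (fun _ : V => a).
Proof.
elim: k a => [|k IH] a /=; first by move=> x _; exact: cst_continuous.
split=> [x _|v]; first exact: differentiable_cst.
rewrite (_ : 'D_v _ = fun=> 0) //; apply/funext => x; exact: derive_cst.
Qed.

Lemma Ck_linear (R : realType) (V W : normedModType R) k (U : set V)
    (f : {linear V -> W}) : continuous f -> Ck k U f.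
Proof.
move=> cf; case: k => [x _|k]; first exact: cf.
split=> [x _|v]; first exact: linear_differentiable.
rewrite (_ : 'D_v _ = fun=> f v); first exact: Ck_cst.
apply/funext => x; rewrite deriveE ?diff_lin //.
exact: linear_differentiable.
Qed.

Lemma CkD (R : realType) (V W : normedModType R) k (U : set V)
    (f g : V -> W) : open U ->
  Ck k U f -> Ck k U g -> Ck k U (fun x => f x + g x).
Proof.
move=> oU; elim: k f g => [|k IH] f g /=.
  by move=> cf cg x Ux; apply: cvgD; [exact: cf|exact: cg].
move=> [df Df] [dg Dg]; split=> [x Ux|v].
  by apply: differentiableD; [exact: df|exact: dg].
apply: Ck_eq (IH _ _ (Df v) (Dg v)) => // x Ux.
by rewrite deriveD //; apply: diff_derivable; [exact: df|exact: dg].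
Qed.

Lemma CkM (R : realType) (V : normedModType R) k (U : set V)
    (f g : V -> R) : open U ->
  Ck k U f -> Ck k U g -> Ck k U (fun x => f x * g x).
Proof.
move=> oU; elim: k f g => [|k IH] f g cf cg.
  by move=> x Ux; apply: cvgM; [exact: cf|exact: cg].
have [df Df] := cf; have [dg Dg] := cg; split=> [x Ux|v].
  by apply: differentiableM; [exact: df|exact: dg].
apply: Ck_eq (CkD oU (IH _ _ (CkS cf) (Dg v)) (IH _ _ (CkS cg) (Df v))) => //.
move=> x Ux; rewrite deriveM //.
  by apply: diff_derivable; exact: df.
by apply: diff_derivable; exact: dg.
Qed.

Lemma CkMl (R : realType) (V : normedModType R) k (U : set V) (a : R)
    (f : V -> R) : open U -> Ck k U f -> Ck k U (fun x => a * f x).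
Proof. by move=> oU; apply: CkM => //; exact: Ck_cst. Qed.

Lemma CkN (R : realType) (V : normedModType R) k (U : set V)
    (f : V -> R) : open U -> Ck k U f -> Ck k U (fun x => - f x).
Proof.
move=> oU /(CkMl (-1) oU); apply: Ck_eq => // x _; exact: mulN1r.
Qed.

Lemma Ck_sum (R : realType) (V W : normedModType R) k (U : set V) (I : Type)
    (r : seq I) (f : I -> V -> W) : open U ->
  (forall i, Ck k U (f i)) -> Ck k U (fun x => \sum_(i <- r) f i x).
Proof.
move=> oU cf; elim: r => [|i r IH].
  by under eq_fun do rewrite big_nil; exact: Ck_cst.
by under eq_fun do rewrite big_cons; exact: CkD.
Qed.

Lemma CkX (R : realType) (V : normedModType R) k (U : set V) m
    (f : V -> R) : open U -> Ck k U f -> Ck k U (fun x => f x ^+ m).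
Proof.
move=> oU cf; elim: m => [|m IH]; first exact: Ck_cst.
by under eq_fun do rewrite exprS; exact: CkM.
Qed.

Lemma Ck_rowP (R : realType) (V : normedModType R) n k (U : set V)
    (f : V -> 'rV[R]_n) : open U ->
  Ck k U f <-> forall i, Ck k U (fun x => f x ord0 i).
Proof.
move=> oU; elim: k f => [|k IH] f.
  split=> [cf i x Ux|cf x Ux].
    exact: (continuous_comp (cf x Ux) (@coord_continuous _ _ _ _ _ _)).
  suff -> : f = fun y => \sum_i f y ord0 i *: delta_mx ord0 i.
    apply: (@Ck_sum R V _ 0 U) => // i y Uy.
    by apply: cvgZr_tmp; exact: cf.
  by apply/funext => y; exact: row_sum_delta.
split=> [[df Df] i|cf].
  split=> [x Ux|v]; first exact: (differentiable_rowP _ _).1 (df x Ux) i.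
  apply: Ck_eq ((IH _).1 (Df v) i) => // x Ux.
  by apply: derive_coord; exact: df.
have df x (Ux : U x) : differentiable f x.
  by apply/differentiable_rowP => i; exact: (cf i).1.
split=> // v; apply/IH => i; apply: Ck_eq ((cf i).2 v) => // x Ux.
by rewrite derive_coord //; exact: df.
Qed.

Lemma differentiable_bigsum (R : realType) (V W : normedModType R) (I : Type)
    (s : seq I) (f : I -> V -> W) x : (forall i, differentiable (f i) x) ->
  differentiable (fun y => \sum_(i <- s) f i y) x.
Proof.
move=> df; elim: s => [|i s IH].
  by under eq_fun do rewrite big_nil; exact: differentiable_cst.
by under eq_fun do rewrite big_cons; exact: differentiableD.
Qed.

Lemma derive_bigsum (R : realType) (V W : normedModType R) (I : Type)
    (s : seq I) (f : I -> V -> W) x v : (forall i, differentiable (f i) x) ->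
  'D_v (fun y => \sum_(i <- s) f i y) x = \sum_(i <- s) 'D_v (f i) x.
Proof.
move=> df; elim: s => [|i s IH].
  by under eq_fun do rewrite big_nil; rewrite derive_cst big_nil.
under eq_fun do rewrite big_cons; rewrite big_cons -IH deriveD //.
  exact: diff_derivable.
by apply: diff_derivable; exact: differentiable_bigsum.
Qed.

Lemma derive_comp (R : realType) (V' V W : normedModType R)
    (r : V' -> V) (f : V -> W) x v :
  differentiable r x -> differentiable f (r x) ->
  'D_v (fun y => f (r y)) x = 'D_('D_v r x) f (r x).
Proof.
move=> dr df; rewrite -!derive_diffE //; last exact: differentiable_comp.
by rewrite (diff_comp dr df).
Qed.

(** The chain rule differentiates f in the direction ['D_v r x], which moves with x, while [Ck]
    iterates derivatives in fixed directions. Writing r over a finite family b yields a sum of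
    products of ['D_v (c i) x] and ['D_(b i) f (r x)], to which the induction applies. *)
Lemma Ck_comp (R : realType) (V' V : normedModType R) (I : finType)
    (b : I -> V) (c : I -> V' -> R) k (U' : set V') (U : set V)
    (f : V -> R) (r : V' -> V) :
  open U' -> (forall x, U' x -> U (r x)) ->
  (forall x, r x = \sum_i c i x *: b i) ->
  (forall i, Ck k U' (c i)) -> Ck k U f -> Ck k U' (fun x => f (r x)).
Proof.
move=> oU' UU' rE.
have rE' : r = fun x => \sum_i c i x *: b i by exact/funext.
elim: k f => [|k IH] f cc cf.
  move=> x Ux; apply: (@continuous_comp _ _ _ r f); last exact/cf/UU'.
  rewrite rE'; apply: (@Ck_sum R V' V 0 U') => // i y Uy.
  by apply: cvgZr_tmp; exact: cc.
have [df Df] := cf; have dr x (Ux : U' x) : differentiable r x.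
  rewrite rE'; apply: differentiable_bigsum => i; apply: differentiableZl.
  exact: (cc i).1.
split=> [x Ux|v].
  by apply: (differentiable_comp (dr x Ux)); exact/df/UU'.
apply: (@Ck_eq _ _ _ _ _
  (fun x => \sum_i 'D_v (c i) x * 'D_(b i) f (r x))) => //.
  move=> x Ux; have dfx : differentiable f (r x) by exact/df/UU'.
  rewrite derive_comp //; last exact: dr.
  rewrite -derive_diffE //.
  have -> : 'D_v r x = \sum_i 'D_v (c i) x *: b i.
    rewrite rE' derive_bigsum => [|i].
      apply: eq_bigr => i _; have dc : differentiable (c i) x by exact: (cc i).1.
      by rewrite -derive_diffE ?diffZl ?derive_diffE //; exact: differentiableZl.
    by apply: differentiableZl; exact: (cc i).1.
  rewrite linear_sum; apply: eq_bigr => i _.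
  by rewrite linearZ derive_diffE.
apply: Ck_sum => // i; apply: CkM => //; first exact: (cc i).2.
by apply: IH (Df (b i)) => j; apply: CkS.
Qed.

Lemma Ck_comp1 (R : realType) (V : normedModType R) k (U : set V)
    (D : set R) (g : R -> R) (f : V -> R) :
  open U -> (forall x, U x -> D (f x)) ->
  Ck k U f -> Ck k D g -> Ck k U (fun x => g (f x)).
Proof.
move=> oU UD cf cg.
apply: (@Ck_comp R V R unit (fun=> 1) (fun=> f) k U D g f) => // x.
by rewrite big_const /= card_unit /= addr0 /GRing.scale /= mulr1.
Qed.

Lemma derive_comp1 (R : realType) (V : normedModType R)
    (g : R -> R) (f : V -> R) x v :
  differentiable f x -> derivable g (f x) 1 ->
  'D_v (fun y => g (f y)) x = derive1 g (f x) * 'D_v f x.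
Proof.
move=> df /[dup] dg /derivable1_diffP dg'.
by rewrite derive_comp // -derive_diffE // deriv1E //= mulrC.
Qed.

(** The derivative of 1/x is a polynomial in 1/x, so each order follows from the previous one. *)
Lemma Ck_pos_inv (R : realType) k : Ck k [set x : R | 0 < x] GRing.inv.
Proof.
elim: k => [|k IH].
  by move=> x /= x0; apply: inv_continuous; rewrite gt_eqF.
have o0 : open [set x : R | 0 < x] by exact: open_gt.
split=> [x /= x0|v]; first by apply: differentiable_Rinv; rewrite gt_eqF.
apply: (@Ck_eq R R R k _ (fun x => - v * (x^-1 * x^-1))) => // [x /= x0|].
  rewrite -[GRing.inv]/(fun y => (id y)^-1) deriveV ?gt_eqF //= derive_id.
  by rewrite /GRing.scale /= -exprVn; ring.
by apply: CkMl => //; exact: CkM.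
Qed.

Lemma Ck_inv (R : realType) (V : normedModType R) k (U : set V)
    (f : V -> R) : open U -> (forall x, U x -> 0 < f x) ->
  Ck k U f -> Ck k U (fun x => (f x)^-1).
Proof. by move=> oU f0 cf; apply: Ck_comp1 f0 cf _ => //; exact: Ck_pos_inv. Qed.

Lemma Ck_pos_sqrt (R : realType) k : Ck k [set x : R | 0 < x] Num.sqrt.
Proof.
have o0 : open [set x : R | 0 < x] by exact: open_gt.
elim: k => [|k IH]; first by move=> x _; exact: sqrt_continuous.
have ds (x : R) : 0 < x -> is_derive x 1 Num.sqrt (2 * Num.sqrt x)^-1.
  exact: is_derive1_sqrt.
split=> [x /= x0|v].
  by apply/derivable1_diffP; have [] := ds x x0.
apply: (@Ck_eq R R R k _ (fun x => v * (2 * Num.sqrt x)^-1)) => // [x /= x0|].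
  have [d1 d2] := ds x x0; have /derivable1_diffP d3 := d1.
  by rewrite -derive_diffE // deriv1E //= derive1E d2.
apply: CkMl => //; apply: Ck_inv => //; last exact: CkMl.
by move=> x /= x0; rewrite mulr_gt0 // sqrtr_gt0.
Qed.

Lemma Ck_sqrt (R : realType) (V : normedModType R) k (U : set V)
    (f : V -> R) : open U -> (forall x, U x -> 0 < f x) ->
  Ck k U f -> Ck k U (fun x => Num.sqrt (f x)).
Proof. by move=> oU f0 cf; apply: Ck_comp1 f0 cf _ => //; exact: Ck_pos_sqrt. Qed.

(** * Smooth functions of one variable *)

Lemma Cinfty_derivable (R : realType) (f : R -> R) t :
  Cinfty setT f -> derivable f t 1.
Proof. by move=> cf; apply/derivable1_diffP; exact: (cf 1%N).1. Qed.

Lemma Cinfty_continuous (R : realType) (f : R -> R) :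
  Cinfty setT f -> continuous f.
Proof. by move=> cf t; exact: (cf 0%N). Qed.

Lemma Cinfty_derive1 (R : realType) (f : R -> R) :
  Cinfty setT f -> Cinfty setT (derive1 f).
Proof.
move=> cf k; have := (cf k.+1).2 1.
by congr (Ck _ _ _); apply/funext => t; rewrite derive1E.
Qed.

Lemma Ck_derive1 (R : realType) k (f : R -> R) :
  (forall t, derivable f t 1) -> Ck k setT (derive1 f) -> Ck k.+1 setT f.
Proof.
move=> df cf'; split=> [t _|v]; first exact/derivable1_diffP.
apply: (@Ck_eq R R R k _ (fun t => v * derive1 f t)) => [|t _|].
- exact: openT.
- rewrite -derive_diffE; last exact/derivable1_diffP.
  by rewrite deriv1E.
- by apply: CkMl => //; exact: openT.
Qed.

Lemma Cinfty_of_derive1n (R : realType) (f : R -> R) :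
  (forall k t, derivable (derive1n k f) t 1) -> Cinfty setT f.
Proof.
move=> df k; elim: k f df => [|k IH] f df.
  move=> t _; apply/differentiable_continuous/derivable1_diffP.
  exact: (df 0%N).
apply: Ck_derive1 => [t|]; first exact: (df 0%N).
by apply: IH => j t; rewrite -derive1Sn.
Qed.

(** The intermediate point is s * t with s in [0, 1], so that t of either sign, or zero, is covered
    at once: the mean value theorem is applied to s |-> f (s t) on [0, 1]. *)
Lemma mvt_origin (R : realType) (f : R -> R) (t : R) :
  (forall s, 0 <= s <= 1 -> derivable f (s * t) 1) ->
  exists2 s, 0 <= s <= 1 & f t - f 0 = derive1 f (s * t) * t.
Proof.
move=> df; pose g s := f (s * t).
have gd (s : R) : 0 <= s <= 1 -> is_derive s 1 g (derive1 f (s * t) * t).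
  move=> s01; have dm : is_derive s 1 ( *%R^~ t) t.
    apply: is_derive_eq (is_deriveM (is_derive_id s 1) (is_derive_cst t s 1)) _.
    by rewrite scaler0 add0r /GRing.scale /= mulr1.
  have dfs : is_derive (s * t) 1 f (derive1 f (s * t)).
    by rewrite derive1E; apply: derivableP; exact: df.
  exact: is_derive1_comp.
have [||s s01] := @MVT R g (fun s => derive1 f (s * t) * t) 0 1 ltr01.
- by move=> s; rewrite in_itv /= => /andP[s0 s1]; apply: gd; rewrite !ltW.
- apply: derivable_within_continuous => s; rewrite in_itv /= => s01.
  by have [] := gd s s01.
rewrite /g mul1r mul0r subr0 mulr1 => E; exists s => //.
by move: s01; rewrite in_itv /= => /andP[s0 s1]; rewrite !ltW.
Qed.

(** The degree is below m: [taylor m.+1] is the Taylor polynomial of order m. *)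
Definition taylor (R : realType) (m : nat) (a : R -> R) : {poly R} :=
  \poly_(j < m) (derive1n j a 0 / j`!%:R).

Lemma taylorS (R : realType) m (a : R -> R) t :
  (taylor m.+1 a).[t] = (taylor m a).[t] + derive1n m a 0 / m`!%:R * t ^+ m.
Proof. by rewrite !horner_poly big_ord_recr. Qed.

Lemma taylor_at0 (R : realType) m (a : R -> R) : (taylor m.+1 a).[0] = a 0.
Proof.
rewrite horner_poly big_ord_recl big1 /= ?addr0 => [|i _].
  by rewrite expr0 mulr1 fact0 divr1.
by rewrite expr0n mulr0.
Qed.

Lemma natr_fact_neq0 (R : realType) m : m`!%:R != 0 :> R.
Proof. by rewrite pnatr_eq0 -lt0n fact_gt0. Qed.

Lemma deriv_taylor (R : realType) m (a : R -> R) :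
  deriv (taylor m.+1 a) = taylor m (derive1 a).
Proof.
apply/polyP => i; rewrite coef_deriv !coef_poly ltnS.
case: ifP => _; last by rewrite mul0rn.
rewrite derive1Sn factS natrM -[LHS]mulr_natr.
have i0 : i.+1%:R != 0 :> R by rewrite pnatr_eq0.
have f0 := natr_fact_neq0 R i.
by move: (i.+1%:R) i0 (i`!%:R) f0 => x x0 y y0; field; rewrite x0 y0.
Qed.

Lemma is_derive_taylor (R : realType) m (a : R -> R) (t : R) :
  is_derive t 1 (fun t => (taylor m.+1 a).[t]) (taylor m (derive1 a)).[t].
Proof. by rewrite -deriv_taylor; exact: is_derive_poly. Qed.

(** Taylor's formula with Peano remainder. The derivative of the remainder of a is the remainder of
    a' one order lower, and the mean value theorem between 0 and t gains the missing factor |t|; the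
    radius d is inherited unchanged. *)
Lemma taylor_young (R : realType) m (a : R -> R) : Cinfty setT a ->
  forall e : R, 0 < e -> exists2 d : R, 0 < d &
    forall t : R, `|t| < d -> `|a t - (taylor m.+1 a).[t]| <= e * `|t| ^+ m.
Proof.
elim: m a => [|m IH] a ca e e0.
  have /cvgrPdist_le /(_ _ e0) /nbhs_ballP [d d0 H] := @Cinfty_continuous _ _ ca 0.
  exists d => // t td; rewrite expr0 mulr1 taylorS.
  rewrite horner_poly big_ord0 add0r expr0 mulr1 fact0 divr1 distrC.
  by apply: H; rewrite /ball /= sub0r normrN.
have [d d0 H] := IH _ (Cinfty_derive1 ca) _ e0.
exists d => // t td; pose f s := a s - (taylor m.+2 a).[s].
have fd (s : R) : is_derive s 1 f (derive1 a s - (taylor m.+1 (derive1 a)).[s]).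
  apply: is_deriveB; last exact: is_derive_taylor.
  by rewrite derive1E; apply: derivableP; exact: Cinfty_derivable.
have [s _|s /andP[s0 s1]] := @mvt_origin _ f t; first by have [] := fd (s * t).
have ct : `|s * t| <= `|t| by rewrite normrM ger0_norm // ler_piMl.
move: (s * t) ct => c ct.
rewrite {1 2}/f taylor_at0 subrr subr0 => ->.
rewrite normrM derive1E; have [_ ->] := fd c.
rewrite exprSr mulrA ler_wpM2r //.
apply: le_trans (H _ (le_lt_trans ct td)) _.
by apply: ler_wpM2l; [exact: ltW|exact: lerXn2r].
Qed.

(* The Taylor quotient (a - taylor m a) / t^m, written so that its value at 0,
   where the division gives 0, is its limit.  These quotients form a family
   closed under differentiation, whence their smoothness. *)
Definition tquot (R : realType) (m : nat) (a : R -> R) (t : R) : R :=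
  derive1n m a 0 / m`!%:R + (a t - (taylor m.+1 a).[t]) / t ^+ m.

Lemma tquot_at0 (R : realType) m (a : R -> R) :
  tquot m a 0 = derive1n m a 0 / m`!%:R.
Proof. by rewrite /tquot taylor_at0 subrr mul0r addr0. Qed.

Lemma tquot_neq0 (R : realType) m (a : R -> R) (t : R) : t != 0 ->
  tquot m a t = (a t - (taylor m a).[t]) / t ^+ m.
Proof.
move=> t0; rewrite /tquot taylorS; field.
by rewrite expf_neq0 ?natr_fact_neq0.
Qed.

Lemma tquot_continuous (R : realType) m (a : R -> R) (t : R) :
  Cinfty setT a -> {for t, continuous (tquot m a)}.
Proof.
move=> ca; have [->|t0] := eqVneq t 0.
  apply/cvgrPdist_le => e e0; have [d d0 H] := taylor_young m ca e0.
  apply/nbhs_ballP; exists d => // s; rewrite /ball /= sub0r normrN => sd.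
  rewrite tquot_at0 /tquot opprD addNKr normrN normrM.
  have [->|s0] := eqVneq s 0.
    by rewrite taylor_at0 subrr normr0 mul0r ltW.
  by rewrite normfV normrX ler_pdivrMr ?exprn_gt0 ?normr_gt0 //; exact: H.
apply: cvgD; first exact: cvg_cst.
apply: cvgM.
  apply: cvgB; first exact: Cinfty_continuous.
  exact: continuous_horner.
by apply: cvgV; [rewrite expf_neq0|exact: exprn_continuous].
Qed.

(** Off 0 this is the quotient rule: the degree m - 1 term of the polynomial of a' and m times the
    degree m term of that of a contribute the same amount and cancel. At 0 the difference quotient
    of [tquot m a] is exactly [tquot m.+1 a], so differentiability there is the continuity of the
    next quotient. *)
Lemma tquot_derive (R : realType) m (a : R -> R) (t : R) :
  Cinfty setT a ->
  is_derive t 1 (tquot m a) (tquot m (derive1 a) t - m%:R * tquot m.+1 a t).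
Proof.
move=> ca; have [->|t0] := eqVneq t 0.
  have E : tquot m (derive1 a) 0 - m%:R * tquot m.+1 a 0 = tquot m.+1 a 0.
    rewrite !tquot_at0 -derive1Sn factS natrM -natr1.
    have m0 : m%:R + 1 != 0 :> R by rewrite natr1 pnatr_eq0.
    have f0 := natr_fact_neq0 R m.
    by move: (m%:R : R) m0 (m`!%:R : R) f0 => x x0 y y0; field; rewrite x0 y0.
  rewrite E; have /continuous_withinNx ct := tquot_continuous (t := 0) (m := m.+1) ca.
  have ct' : h^-1 *: (tquot m a (h *: 1 + 0) - tquot m a 0) @[h --> 0^'] -->
      tquot m.+1 a 0.
    apply: cvg_trans ct; apply: near_eq_cvg; near=> h.
    have h0 : h != 0 by near: h; exact: nbhs_dnbhs_neq.
    rewrite /GRing.scale /= mulr1 addr0 tquot_at0 tquot_neq0 // /tquot.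
    by rewrite exprS; field; rewrite h0 natr_fact_neq0 expf_neq0.
  by split; [apply/cvg_ex; exists (tquot m.+1 a 0)|exact: cvg_lim].
have dX : is_derive t 1 (fun t => (t ^+ m)^-1) (- m%:R * t ^- m.+1).
  split.
    apply: derivableV; first by rewrite expf_neq0.
    exact: exprn_derivable.
  rewrite deriveV ?expf_neq0 //; last exact: exprn_derivable.
  rewrite exp_derive /GRing.scale /= mulr1.
  case: (m) => [|k]; first by rewrite !mulr0n !mul0r oppr0 mulr0 mul0r.
  by rewrite /= !exprS; field; rewrite t0 expf_neq0.
have dN : is_derive t 1 (fun t => a t - (taylor m.+1 a).[t])
    (derive1 a t - (taylor m (derive1 a)).[t]).
  apply: is_deriveB; last exact: is_derive_taylor.
  by rewrite derive1E; apply: derivableP; exact: Cinfty_derivable.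
apply: (@is_derive_eq _ _ _ _ _ _ _ _ (is_deriveD (is_derive_cst _ _ _) (is_deriveM dN dX))).
rewrite !tquot_neq0 // /GRing.scale /= exprS.
by field; rewrite t0 expf_neq0.
Unshelve. all: by end_near. Qed.

Lemma tquot_Cinfty (R : realType) m (a : R -> R) :
  Cinfty setT a -> Cinfty setT (tquot m a).
Proof.
move=> ca k; elim: k m a ca => [|k IH] m a ca.
  by move=> t _; exact: tquot_continuous.
have d t := tquot_derive m t ca.
apply: Ck_derive1 => [t|]; first by have [] := d t.
have -> : derive1 (tquot m a) =
    fun t => tquot m (derive1 a) t + - m%:R * tquot m.+1 a t.
  by apply/funext => t; rewrite derive1E mulNr; have [] := d t.
apply: CkD; [exact: openT|exact/IH/Cinfty_derive1|].
by apply: CkMl; [exact: openT|exact: IH].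
Qed.

(* For an even function a, [sharp a] extends t |-> a'(t) / t. *)
Definition sharp (R : realType) (a : R -> R) : R -> R := tquot 1 (derive1 a).

Lemma even_derive1 (R : realType) (a : R -> R) t :
  (forall t, derivable a t 1) -> (forall t, a (- t) = a t) ->
  derive1 a (- t) = - derive1 a t.
Proof.
move=> da ea; have -> : derive1 a t = derive1 (a \o -%R) t.
  by congr (derive1 _ t); apply/funext => s /=.
rewrite (@derive1_comp R -%R a t (@derivable_opp R t 1) (da (- t))).
by rewrite (@derive1N _ id) // derive1_id mulrN1 opprK.
Qed.

Lemma even_derive10 (R : realType) (a : R -> R) :
  (forall t, derivable a t 1) -> (forall t, a (- t) = a t) -> derive1 a 0 = 0.
Proof.
move=> da ea; have := even_derive1 0 da ea; rewrite oppr0 => E.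
lra.
Qed.

Lemma sharpE (R : realType) (a : R -> R) t : derive1 a 0 = 0 ->
  t * sharp a t = derive1 a t.
Proof.
move=> a0; have [->|t0] := eqVneq t 0; first by rewrite mul0r.
rewrite /sharp tquot_neq0 // horner_poly big_ord1 expr0 /= a0 mul0r mul0r subr0.
by rewrite expr1 mulrC divfK.
Qed.

Lemma sharp0 (R : realType) (a : R -> R) : sharp a 0 = derive1n 2 a 0.
Proof. by rewrite /sharp tquot_at0 divr1. Qed.

Lemma sharp_even (R : realType) (a : R -> R) t :
  (forall t, derivable a t 1) -> (forall t, a (- t) = a t) ->
  sharp a (- t) = sharp a t.
Proof.
move=> da ea; have [->|t0] := eqVneq t 0; first by rewrite oppr0.
have a0 := even_derive10 da ea; apply: (mulfI t0).
by rewrite sharpE // -[LHS]opprK -mulNr sharpE // even_derive1 // opprK.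
Qed.

Lemma sharp_Cinfty (R : realType) (a : R -> R) :
  Cinfty setT a -> Cinfty setT (sharp a).
Proof. by move=> ca; exact/tquot_Cinfty/Cinfty_derive1. Qed.

(** * Euclidean geometry and radial functions *)

Lemma dotC (R : realType) m (u v : 'rV[R]_m) : dot u v = dot v u.
Proof. by apply: eq_bigr => i _; rewrite mulrC. Qed.

Lemma dotDl (R : realType) m (u v w : 'rV[R]_m) :
  dot (u + v) w = dot u w + dot v w.
Proof. by rewrite /dot -big_split; apply: eq_bigr => i _; rewrite mxE mulrDl. Qed.

Lemma dotZl (R : realType) m (a : R) (u w : 'rV[R]_m) :
  dot (a *: u) w = a * dot u w.
Proof. by rewrite /dot mulr_sumr; apply: eq_bigr => i _; rewrite mxE mulrA. Qed.

Lemma dotDr (R : realType) m (u v w : 'rV[R]_m) :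
  dot w (u + v) = dot w u + dot w v.
Proof. by rewrite dotC dotDl !(dotC w). Qed.

Lemma dotZr (R : realType) m (a : R) (u w : 'rV[R]_m) :
  dot w (a *: u) = a * dot w u.
Proof. by rewrite dotC dotZl (dotC w). Qed.

Lemma dot0l (R : realType) m (w : 'rV[R]_m) : dot 0 w = 0.
Proof. by rewrite -(scale0r 0) dotZl mul0r. Qed.

Lemma dot0r (R : realType) m (w : 'rV[R]_m) : dot w 0 = 0.
Proof. by rewrite dotC dot0l. Qed.

Lemma dot_row (R : realType) m1 m2 (u u' : 'rV[R]_m1) (v v' : 'rV[R]_m2) :
  dot (row_mx u v) (row_mx u' v') = dot u u' + dot v v'.
Proof.
rewrite /dot big_split_ord /=; congr (_ + _); apply: eq_bigr => i _.
  by rewrite !row_mxEl.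
by rewrite !row_mxEr.
Qed.

Lemma dot_ge0 (R : realType) m (u : 'rV[R]_m) : 0 <= dot u u.
Proof. by apply: sumr_ge0 => i _; rewrite -expr2 sqr_ge0. Qed.

Lemma dot_eq0 (R : realType) m (u : 'rV[R]_m) : (dot u u == 0) = (u == 0).
Proof.
apply/eqP/eqP => [|->]; last exact: dot0l.
move=> /eqP; rewrite psumr_eq0 => [/allP u0|i _]; last by rewrite -expr2 sqr_ge0.
apply/rowP => i; rewrite mxE; apply/eqP.
by have /= := u0 i; rewrite mem_index_enum -expr2 sqrf_eq0; apply.
Qed.

Lemma dot_gt0 (R : realType) m (u : 'rV[R]_m) : (0 < dot u u) = (u != 0).
Proof. by rewrite lt0r dot_ge0 dot_eq0 andbT. Qed.

Lemma enorm_ge0 (R : realType) m (u : 'rV[R]_m) : 0 <= enorm u.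
Proof. exact: sqrtr_ge0. Qed.

Lemma sqr_enorm (R : realType) m (u : 'rV[R]_m) : enorm u ^+ 2 = dot u u.
Proof. by rewrite sqr_sqrtr // dot_ge0. Qed.

Lemma enorm_eq0 (R : realType) m (u : 'rV[R]_m) : (enorm u == 0) = (u == 0).
Proof. by rewrite -sqrf_eq0 sqr_enorm dot_eq0. Qed.

Lemma enorm_gt0 (R : realType) m (u : 'rV[R]_m) : (0 < enorm u) = (u != 0).
Proof. by rewrite lt0r enorm_ge0 enorm_eq0 andbT. Qed.

Lemma enorm0 (R : realType) m : enorm (0 : 'rV[R]_m) = 0.
Proof. by apply/eqP; rewrite enorm_eq0. Qed.

Lemma enormZ (R : realType) m (a : R) (u : 'rV[R]_m) :
  enorm (a *: u) = `|a| * enorm u.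
Proof.
by rewrite /enorm dotZl dotZr mulrA -expr2 sqrtrM ?sqr_ge0 // sqrtr_sqr.
Qed.

(** Differentials are taken for the sup norm and radial functions use the Euclidean one; this crude
    constant lets estimates pass from one to the other. *)
Lemma enorm_le_norm (R : realType) m (u : 'rV[R]_m) :
  enorm u <= m%:R * `|u|.
Proof.
have u0 : 0 <= m%:R * `|u| by rewrite mulr_ge0.
rewrite -(ler_pXn2r (n := 2)) ?nnegrE ?enorm_ge0 // sqr_enorm.
apply: (@le_trans _ _ (\sum_(i < m) `|u| ^+ 2)).
  apply: ler_sum => i _; rewrite -expr2 -real_normK ?num_real //.
  rewrite lerXn2r ?nnegrE // /Num.norm /= mx_normrE.
  exact: (le_bigmax _ (fun i => `|u i.1 i.2|) (ord0, i)).
rewrite sumr_const card_ord -[leLHS]mulr_natl exprMn ler_wpM2r ?sqr_ge0 //.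
by rewrite -natrX ler_nat; case: m {u u0} => // m; rewrite leq_pmulr.
Qed.

Lemma Ck_dot (R : realType) (V : normedModType R) m k (U : set V)
    (f g : V -> 'rV[R]_m) : open U ->
  Ck k U f -> Ck k U g -> Ck k U (fun x => dot (f x) (g x)).
Proof.
move=> oU /(Ck_rowP _ _ oU) cf /(Ck_rowP _ _ oU) cg.
by apply: (Ck_sum _ oU) => i; apply: CkM.
Qed.

Lemma derive_dot (R : realType) (V : normedModType R) m
    (f g : V -> 'rV[R]_m) x v : differentiable f x -> differentiable g x ->
  'D_v (fun x => dot (f x) (g x)) x = dot ('D_v f x) (g x) + dot (f x) ('D_v g x).
Proof.
move=> df dg.
have dfi i : differentiable (fun y => f y ord0 i) x.
  by move/differentiable_rowP: df.
have dgi i : differentiable (fun y => g y ord0 i) x.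
  by move/differentiable_rowP: dg.
rewrite derive_bigsum => [|i]; last exact: differentiableM.
rewrite /dot -big_split /=; apply: eq_bigr => i _.
rewrite deriveM; [|exact: diff_derivable..].
rewrite !derive_coord // addrC; congr (_ + _); exact: mulrC.
Qed.

Lemma differentiable_dot (R : realType) (V : normedModType R) m
    (f g : V -> 'rV[R]_m) x : differentiable f x -> differentiable g x ->
  differentiable (fun x => dot (f x) (g x)) x.
Proof.
move=> /differentiable_rowP df /differentiable_rowP dg.
by apply: differentiable_bigsum => i; exact: differentiableM.
Qed.

Lemma derive_linear (R : realType) (V W : normedModType R)
    (L : {linear V -> W}) x v : continuous L -> 'D_v L x = L v.
Proof.
move=> cL; rewrite -derive_diffE; last exact: linear_differentiable.
by rewrite diff_lin.
Qed.

Lemma derive_enorm (R : realType) (V : normedModType R) m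
    (f : V -> 'rV[R]_m) x v : differentiable f x -> f x != 0 ->
  differentiable (fun y => enorm (f y)) x /\
  'D_v (fun y => enorm (f y)) x = dot (f x) ('D_v f x) / enorm (f x).
Proof.
move=> df f0; have d0 : 0 < dot (f x) (f x) by rewrite dot_gt0.
have ds : is_derive (dot (f x) (f x)) 1 Num.sqrt (2 * enorm (f x))^-1.
  exact: is_derive1_sqrt.
have dd := differentiable_dot df df.
split.
  apply: (@differentiable_comp _ _ _ _ (fun y => dot (f y) (f y)) Num.sqrt) => //.
  by apply/derivable1_diffP; have [] := ds.
rewrite (@derive_comp1 _ _ Num.sqrt (fun y => dot (f y) (f y))) //.
rewrite derive1E; have [_ ->] := ds; rewrite derive_dot // dotC.
by field; rewrite enorm_eq0.
Qed.

(** Where L p <> 0 this is the chain rule through the Euclidean norm. Where L p = 0 the norm may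
    fail to be differentiable, but a'(0) = 0 gives a(r) = a(0) + o(r), and |L h| is bounded by a
    multiple of |h|; so the differential is 0, as is the right-hand side. *)
Lemma radial_differentiable (R : realType) (V : normedModType R) m
    (L : {linear V -> 'rV[R]_m}) (a : R -> R) p v : continuous L ->
  Cinfty setT a -> derive1 a 0 = 0 ->
  differentiable (fun p => a (enorm (L p))) p /\
  'D_v (fun p => a (enorm (L p))) p = sharp a (enorm (L p)) * dot (L p) (L v).
Proof.
move=> cL ca a0; have dL : differentiable L p by exact: linear_differentiable.
have [Lp0|Lp0] := eqVneq (L p) 0; last first.
  have [de De] := derive_enorm v dL Lp0.
  have da : derivable a (enorm (L p)) 1 by exact: Cinfty_derivable.
  split.
    apply: (@differentiable_comp _ _ _ _ (fun y => enorm (L y)) a) => //.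
    exact/derivable1_diffP.
  rewrite (@derive_comp1 _ _ a (fun y => enorm (L y))) // De derive_linear //.
  by rewrite -sharpE //; field; rewrite enorm_eq0.
have [C C0 LC] : exists2 C : R, 0 < C & forall h, enorm (L h) <= C * `|h|.
  (* The summand 1 keeps the constant positive, even for m = 0, since it is divided by below. *)
  have [k k0 kL] := linear_lipschitz cL; exists (m%:R * k + 1).
    by rewrite ltr_wpDl // mulr_ge0 // ltW.
  move=> h; apply: le_trans (enorm_le_norm _) _.
  rewrite mulrDl mul1r -mulrA; apply: ler_wpDr => //.
  by rewrite ler_wpM2l.
have E : (fun p => a (enorm (L p))) \o shift p =
    cst (a (enorm (L p))) + cst 0 +o_ 0 id.
  apply/eqaddoP => _ /posnumP[e].
  have [d d0 H] := taylor_young 1 ca (divr_gt0 (gt0 e) C0).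
  apply/nbhs_ballP; exists (d / C); first by rewrite /= divr_gt0.
  move=> h; rewrite -ball_normE /= sub0r normrN ltr_pdivlMr // => hd.
  rewrite !fctE /= raddfD /= Lp0 addr0 enorm0 addr0.
  have := H (enorm (L h)); rewrite ger0_norm ?enorm_ge0 // expr1.
  rewrite !taylorS horner_poly big_ord0 /= a0 mul0r mul0r addr0.
  rewrite add0r fact0 divr1 expr0 mulr1.
  move=> H'; apply: le_trans (H' _) _.
    by apply: le_lt_trans (LC h) _; rewrite mulrC.
  rewrite -mulrA ler_wpM2l // mulrC ler_pdivrMr // mulrC; exact: LC.
have D0 : 'd (fun p => a (enorm (L p))) p = (cst 0 : V -> R) :> (V -> R).
  have c0 : continuous (\0%R : {linear V -> R}) by exact: cst_continuous.
  exact: (diff_unique c0 E).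
have df : differentiable (fun p => a (enorm (L p))) p.
  apply/diff_locallyP; split; first by rewrite D0; exact: cst_continuous.
  by rewrite D0.
by split=> //; rewrite Lp0 dot0l mulr0 -derive_diffE // D0.
Qed.

Lemma radial_Ck (R : realType) (V : normedModType R) m
    (L : {linear V -> 'rV[R]_m}) (a : R -> R) k : continuous L ->
  Cinfty setT a -> (forall t, a (- t) = a t) ->
  Ck k setT (fun p => a (enorm (L p))).
Proof.
move=> cL; have oT : open [set: V] by exact: openT.
elim: k a => [|k IH] a ca ea;
  have da t : derivable a t 1 by exact: Cinfty_derivable.
all: have rd p v := radial_differentiable p v cL ca (even_derive10 da ea).
  by move=> p _; apply: differentiable_continuous; have [] := rd p 0.
split=> [p _|v]; first by have [] := rd p 0.
have -> : 'D_v (fun p => a (enorm (L p))) =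
    fun p => sharp a (enorm (L p)) * dot (L p) (L v).
  by apply/funext => p; have [] := rd p v.
apply: CkM => //.
  by apply: IH; [exact: sharp_Cinfty|move=> t; exact: sharp_even].
by apply: Ck_dot => //; [exact: Ck_linear|exact: Ck_cst].
Qed.

(** * The profile functions *)

Section profile.
Context (R : realType) (n : nat) (phi : R -> R).
Hypothesis (hn : (4 <= n)%N) (hphi : tangherlini_profile n phi).

Local Notation M := (mass R n).

Lemma mass_gt0 : 0 < M.
Proof.
by rewrite /mass divr_gt0 // subr_gt0 ltr_nat; exact: leq_trans hn.
Qed.

Lemma phi_Cinfty : Cinfty setT phi.
Proof. by have [dphi _ _ _ _] := hphi; exact: Cinfty_of_derive1n. Qed.

Lemma phi_even t : phi (- t) = phi t.
Proof. by have [_ + _ _ _] := hphi. Qed.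

Lemma phi_at0 : phi 0 = M.
Proof. by have [_ _ [-> _] _ _] := hphi. Qed.

Lemma phi_derivable (t : R) : derivable phi t 1.
Proof. exact/Cinfty_derivable/phi_Cinfty. Qed.

Lemma dphi_derivable (t : R) : derivable (derive1 phi) t 1.
Proof. exact/Cinfty_derivable/Cinfty_derive1/phi_Cinfty. Qed.

Lemma dphi_odd (t : R) : derive1 phi (- t) = - derive1 phi t.
Proof. exact: even_derive1 phi_derivable phi_even. Qed.

Lemma dphi_at0 : derive1 phi 0 = 0.
Proof. by have [_ _ [_ ->] _ _] := hphi. Qed.

Lemma dphi_gt0 (t : R) : 0 < t -> 0 < derive1 phi t.
Proof. by have [_ _ _ _] := hphi; apply. Qed.

Lemma dphi_ge0 (t : R) : 0 <= t -> 0 <= derive1 phi t.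
Proof.
rewrite le_eqVlt => /predU1P[<-|/dphi_gt0/ltW //].
by rewrite dphi_at0.
Qed.

Lemma phi_ge (t : R) : M <= phi t.
Proof.
suff H (s : R) : 0 <= s -> M <= phi s.
  have [t0|t0] := leP 0 t; first exact: H.
  by rewrite -phi_even; apply: H; rewrite oppr_ge0 ltW.
move=> s0; rewrite -phi_at0 -subr_ge0.
have [x _|r /andP[r0 _] ->] := @mvt_origin R phi s; first exact: phi_derivable.
by rewrite mulr_ge0 // dphi_ge0 // mulr_ge0.
Qed.

Lemma phi_gt0 (t : R) : 0 < phi t.
Proof. exact: lt_le_trans mass_gt0 (phi_ge t). Qed.

Lemma phi_neq0 (t : R) : phi t != 0.
Proof. by rewrite gt_eqF ?phi_gt0. Qed.

Lemma sqr_dphi (t : R) : derive1 phi t ^+ 2 = 1 - (M / phi t) ^+ (n - 3).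
Proof.
have [_ _ _ E _] := hphi.
have [/E //|t0] := leP 0 t.
by rewrite -sqrrN -dphi_odd -(phi_even t) E // oppr_ge0 ltW.
Qed.

(** Recovers at 0 the identities obtained by cancelling a factor that vanishes there. *)
Lemma continuous_eq_at0 (f : R -> R) : {for 0, continuous f} ->
  (forall t, t != 0 -> f t = 0) -> f 0 = 0.
Proof.
move=> /continuous_withinNx cf f0.
have c0 : f @ 0^' --> (0 : R).
  apply: cvg_near_cst; near=> t.
  by rewrite f0 //; near: t; exact: nbhs_dnbhs_neq.
exact: cvg_unique cf c0.
Unshelve. all: by end_near. Qed.

Lemma ratio_Ck k : Ck k setT (fun t : R => M / phi t).
Proof.
have oT := @openT R; apply: CkMl => //; apply: Ck_inv => // [x _|].
  exact: phi_gt0.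
exact: phi_Cinfty.
Qed.

(** Differentiating phi'^2 + (mu / phi)^(n-3) = 1 gives 2 phi' (phi'' - (mu / phi)^(n-2)) = 0: the
    value mu = (n-3)/2 absorbs the factor n - 3 produced by the power. The factor phi' is cancelled
    off 0, and 0 is reached by continuity. *)
Lemma d2phi (t : R) : derive1 (derive1 phi) t = (M / phi t) ^+ (n - 2).
Proof.
have dE (s : R) : derive1 phi s *
    (derive1 (derive1 phi) s - (M / phi s) ^+ (n - 2)) = 0.
  have dp : is_derive s 1 phi (derive1 phi s).
    by rewrite derive1E; apply: derivableP; exact: phi_derivable.
  have ddp : is_derive s 1 (derive1 phi) (derive1 (derive1 phi) s).
    by rewrite derive1E; apply: derivableP; exact: dphi_derivable.
  have di : is_derive s 1 (fun s => (phi s)^-1) (- phi s ^- 2 * derive1 phi s).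
    have [dp1 dp2] := dp; have p0 := phi_neq0 s.
    split; first exact: derivableV.
    by rewrite deriveV; [rewrite dp2|exact: p0|exact: dp1].
  have dr : is_derive s 1 (fun s => M / phi s) (M * (- phi s ^- 2 * derive1 phi s)).
    exact: is_deriveZ.
  have [_] := is_deriveD (is_deriveX 2 ddp) (is_deriveX (n - 3) dr).
  set E := (X in derive X _ _).
  have -> : E = cst 1 by apply/funext => r; rewrite /E !fctE sqr_dphi subrK.
  rewrite derive_cst => /esym; rewrite /GRing.scale /= expr1.
  (* [(n - 3).-1] is the exponent left by differentiating the power [n - 3]; the power [n - 2] is
     written over it so that [field] can compare the two. *)
  have -> : (n - 2 = (n - 3).-1.+2)%N by move: hn; lia.
  have nE : (n - 3)%:R = 2 * M :> R.
    rewrite /mass mulrC divfK ?pnatr_eq0 // natrB //; exact: leq_trans hn.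
  rewrite -[_ *+ (n - 3)]mulr_natl nE !exprS expr0 => H.
  apply: (mulfI (x := 2)); first by rewrite pnatr_eq0.
  rewrite mulr0 -{}[RHS]H; field; exact: phi_neq0.
have off0 (s : R) : s != 0 ->
    derive1 (derive1 phi) s - (M / phi s) ^+ (n - 2) = 0.
  move=> s0; apply: (mulfI (x := derive1 phi s)); last by rewrite dE mulr0.
  move: s0; case: ltgtP => // s0 _; last by rewrite gt_eqF // dphi_gt0.
  by rewrite -oppr_eq0 -dphi_odd gt_eqF // dphi_gt0 // oppr_gt0.
apply/eqP; rewrite -subr_eq0; apply/eqP.
have [->|/off0 //] := eqVneq t 0.
apply: (@continuous_eq_at0
  (fun s => derive1 (derive1 phi) s - (M / phi s) ^+ (n - 2))) => //.
have oT := @openT R; apply: (@Ck_continuous R R R 0 setT) => //.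
apply: CkD => //; first exact/Cinfty_derive1/Cinfty_derive1/phi_Cinfty.
by apply: CkN => //; apply: CkX => //; exact: ratio_Ck.
Qed.

Lemma ratio_gt0 (t : R) : 0 < M / phi t.
Proof. by rewrite divr_gt0 ?mass_gt0 ?phi_gt0. Qed.

Lemma d2phi_gt0 (t : R) : 0 < derive1 (derive1 phi) t.
Proof. by rewrite d2phi exprn_gt0 // ratio_gt0. Qed.

Lemma d2phi_at0 : derive1 (derive1 phi) 0 = 1.
Proof. by rewrite d2phi phi_at0 divff ?expr1n // gt_eqF // mass_gt0. Qed.

Lemma sharp_phi_at0 : sharp phi 0 = 1.
Proof. by rewrite sharp0 /derive1n /= d2phi_at0. Qed.

Lemma sharp_phi_gt0 (t : R) : 0 < sharp phi t.
Proof.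
have H (s : R) : 0 < s -> 0 < sharp phi s.
  by move=> s0; rewrite -(pmulr_rgt0 _ s0) sharpE ?dphi_gt0 // dphi_at0.
have [/H //|t0|<-] := ltgtP 0 t; last by rewrite sharp_phi_at0.
rewrite -sharp_even; [|exact: phi_derivable|exact: phi_even].
by apply: H; rewrite oppr_gt0.
Qed.

Lemma dphi_incr (s t : R) : s < t -> derive1 phi s < derive1 phi t.
Proof.
move=> st; rewrite -subr_gt0; pose f (r : R) : R := derive1 phi (r + s).
have fd (r : R) : is_derive r 1 f (derive1 (derive1 phi) (r + s)).
  have d1 : is_derive r 1 (fun r => r + s) 1.
    by apply: is_derive_eq (is_deriveD (is_derive_id r 1) (is_derive_cst s r 1)) _;
       rewrite addr0.
  have d2 : is_derive (r + s) 1 (derive1 phi) (derive1 (derive1 phi) (r + s)).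
    by rewrite derive1E; apply: derivableP; exact: dphi_derivable.
  by have := @is_derive1_comp R (derive1 phi) (fun r => r + s) r _ _ d2 d1; rewrite mulr1.
have [r _|r _] := @mvt_origin R f (t - s); first by have [] := fd (r * (t - s)).
rewrite /f add0r subrK => ->; rewrite mulr_gt0 ?subr_gt0 //.
by rewrite derive1E; have [_ ->] := fd (r * (t - s)); exact: d2phi_gt0.
Qed.

(* psi' = phi' * slope (mu / phi) : the factor 1 - mu / phi common to phi'^2 and
   to 1 - phi'^2 - phi''^2 has been divided out. *)
Definition slope (x : R) : R :=
  Num.sqrt (x ^+ (n - 3) * (\sum_(i < n.-1) x ^+ i) / \sum_(i < n - 3) x ^+ i).

Lemma geom_gt0 m (x : R) : 0 < x -> 0 < \sum_(i < m.+1) x ^+ i.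
Proof.
move=> x0; rewrite big_ord_recl expr0 ltr_pwDl // sumr_ge0 // => i _.
by rewrite exprn_ge0 // ltW.
Qed.

Lemma slope_arg_gt0 (x : R) : 0 < x ->
  0 < x ^+ (n - 3) * (\sum_(i < n.-1) x ^+ i) / \sum_(i < n - 3) x ^+ i.
Proof.
move=> x0.
have -> : (n.-1 = n.-2.+1)%N by move: hn; lia.
have -> : (n - 3 = (n - 4).+1)%N by move: hn; lia.
by rewrite divr_gt0 ?mulr_gt0 ?geom_gt0 // exprn_gt0.
Qed.

Lemma slope_gt0 (x : R) : 0 < x -> 0 < slope x.
Proof. by move=> x0; rewrite sqrtr_gt0 slope_arg_gt0. Qed.

Lemma slope_Ck k : Ck k [set x : R | 0 < x] slope.
Proof.
have o0 : open [set x : R | 0 < x] by exact: open_gt.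
have cX m : Ck k [set x : R | 0 < x] (fun x : R => x ^+ m).
  by apply: CkX => //; apply: (@Ck_linear R R R k _ idfun) => x.
have cS m : Ck k [set x : R | 0 < x] (fun x : R => \sum_(i < m) x ^+ i).
  by apply: Ck_sum => // i; exact: cX.
apply: Ck_sqrt => // [x /= x0|]; first exact: slope_arg_gt0.
apply: CkM => //; first exact: CkM.
have -> : (n - 3 = (n - 4).+1)%N by move: hn; lia.
by apply: Ck_inv => // x /= x0; exact: geom_gt0.
Qed.

(** Each geometric sum times 1 - x is 1 minus a power of x, so the quotient in [slope] exchanges 1 -
    x^(n-3) for 1 - x^(n-1). There is no division by 1 - x, which vanishes at t = 0. *)
Lemma sqr_psi_slope (t : R) : (derive1 phi t * slope (M / phi t)) ^+ 2 =
  1 - derive1 phi t ^+ 2 - derive1 (derive1 phi) t ^+ 2.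
Proof.
rewrite exprMn sqr_sqrtr ?ltW ?slope_arg_gt0 ?ratio_gt0 // d2phi sqr_dphi.
set x := M / phi t; have x0 : 0 < x := ratio_gt0 t.
have S0 : \sum_(i < n - 3) x ^+ i != 0.
  have -> : (n - 3 = (n - 4).+1)%N by move: hn; lia.
  by rewrite gt_eqF // geom_gt0.
have E1 := subrX1 x (n - 3); have E2 := subrX1 x n.-1.
have -> : 1 - x ^+ (n - 3) = (1 - x) * \sum_(i < n - 3) x ^+ i.
  by rewrite -opprB E1 -mulNr opprB.
rewrite [LHS](_ : _ = x ^+ (n - 3) * ((1 - x) * \sum_(i < n.-1) x ^+ i));
  last by field.
have -> : (1 - x) * \sum_(i < n.-1) x ^+ i = 1 - x ^+ n.-1.
  by rewrite -(opprB x) mulNr -E2 opprB.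
have -> : (1 - x) * \sum_(i < n - 3) x ^+ i = 1 - x ^+ (n - 3).
  by rewrite -(opprB x) mulNr -E1 opprB.
rewrite mulrBr mulr1 -exprM -exprD opprB addrCA subrr addr0.
by congr (_ - x ^+ _); move: hn; lia.
Qed.

Lemma primitive_exists (f : R -> R) (c : R) :
  {in [pred x | c <= x], continuous f} ->
  exists F : R -> R, forall x, c < x -> is_derive x 1 F (f x).
Proof.
move=> cf; exists (fun x => \int[lebesgue_measure]_(t in `[c, x]) f t)%R => x cx.
have [|||/=] := @continuous_FTC1_closed R f c x (x + 1) _ _ cx.
- by rewrite ltrDl.
- apply: continuous_compact_integrable; first exact: segment_compact.
  apply: continuous_in_subspaceT => y; rewrite inE /= in_itv /= => /andP[cy _].
  exact: cf.
- by apply: cf; rewrite inE /= ltW.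
by move=> dF F'; split; [exact: dF|rewrite -derive1E; exact: F'].
Qed.

(** [psi] integrates over [0, t], hence is 0 for t < 0; [ps] is its even extension. It is built as
    K(phi) - K(mu), where K is a primitive of r |-> slope(mu / r): evenness comes from phi, and
    smoothness from that of the explicit derivative. *)
Lemma psi_smooth : exists ps : R -> R,
  [/\ Cinfty setT ps, forall t, ps (- t) = ps t,
      forall t, derive1 ps t = derive1 phi t * slope (M / phi t) &
      forall t, 0 <= t -> psi phi t = ps t].
Proof.
have M0 := mass_gt0; have oT := @openT R.
(* [primitive_exists] differentiates only strictly to the right of its base point; mu / 2 lies below
   every value of phi, and is positive, so slope(mu / r) is continuous from there on. *)
have [K dK] : exists K : R -> R, forall r, M / 2 < r ->
    is_derive r 1 K (slope (M / r)).
  apply: (primitive_exists (f := fun r => slope (M / r))) => r.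
  rewrite inE /= => Mr; have r0 : 0 < r by apply: lt_le_trans Mr; rewrite divr_gt0.
  have o0 : open [set x : R | 0 < x] by exact: open_gt.
  apply: (@Ck_continuous R R R 0 [set x | 0 < x]) => //.
  apply: (@Ck_comp1 R R 0 _ [set x | 0 < x] slope (fun r => M / r)) => //.
  - by move=> x /= x0; rewrite divr_gt0.
  - by apply: CkMl => //; exact: Ck_pos_inv.
  - exact: slope_Ck.
pose ps t := K (phi t) - K M.
have dps (t : R) : is_derive t 1 ps (derive1 phi t * slope (M / phi t)).
  have d1 : is_derive t 1 phi (derive1 phi t).
    by rewrite derive1E; apply: derivableP; exact: phi_derivable.
  have d2 : is_derive (phi t) 1 K (slope (M / phi t)).
    by apply: dK; apply: lt_le_trans (phi_ge t); lra.
  apply: is_derive_eq (is_deriveB (is_derive1_comp d2 d1) (is_derive_cst (K M) t 1)) _.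
  by rewrite subr0 mulrC.
have ps' t : derive1 ps t = derive1 phi t * slope (M / phi t).
  by rewrite derive1E; have [_ ->] := dps t.
have cps' : Cinfty setT (fun t => derive1 phi t * slope (M / phi t)).
  move=> k; apply: CkM => //; first exact/Cinfty_derive1/phi_Cinfty.
  apply: (@Ck_comp1 R R k _ [set x | 0 < x] slope) => //.
  - by move=> x _ /=; exact: ratio_gt0.
  - exact: ratio_Ck.
  - exact: slope_Ck.
have cps : Cinfty setT ps.
  move=> k; apply: CkS; apply: Ck_derive1 => [t|]; first by have [] := dps t.
  by have -> := funext ps'; exact: cps'.
exists ps; split => // t; first by rewrite /ps phi_even.
rewrite le_eqVlt => /predU1P[<-|t0].
  by rewrite /psi set_itv1 Rintegral_set1 /ps phi_at0 subrr.
have etaE s : 0 <= s -> eta phi s = derive1 phi s * slope (M / phi s).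
  move=> s0; rewrite /eta -sqr_psi_slope sqrtr_sqr ger0_norm //.
  by rewrite mulr_ge0 ?dphi_ge0 // ltW // slope_gt0 // ratio_gt0.
rewrite /psi /Rintegral.
have -> : (\int[lebesgue_measure]_(s in `[0%R, t]) (eta phi s)%:E =
    \int[lebesgue_measure]_(s in `[0%R, t])
      (derive1 phi s * slope (M / phi s))%:E)%E.
  apply: eq_integral => s; rewrite inE /= in_itv /= => /andP[s0 _].
  by rewrite etaE.
rewrite (@continuous_FTC2 R _ ps 0 t) //=.
- by rewrite /ps phi_at0 subrr subr0.
- apply: continuous_subspaceT => s; exact: (cps' 0%N s).
- split=> [s _||]; first by have [] := dps s.
  + by apply: cvg_at_right_filter; exact: (cps 0%N 0).
  + by apply: cvg_at_left_filter; exact: (cps 0%N t).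
Qed.

End profile.

(** * Vector-valued maps, pairs and normalization *)

Lemma CkZ (R : realType) (V : normedModType R) m k (U : set V)
    (c : V -> R) (f : V -> 'rV[R]_m) : open U ->
  Ck k U c -> Ck k U f -> Ck k U (fun x => c x *: f x).
Proof.
move=> oU cc /(Ck_rowP _ _ oU) cf; apply/(Ck_rowP _ _ oU) => i.
by under eq_fun do rewrite mxE; exact: CkM.
Qed.

Lemma deriveZ_row (R : realType) (V : normedModType R) m
    (c : V -> R) (f : V -> 'rV[R]_m) x v :
  differentiable c x -> differentiable f x ->
  differentiable (fun x => c x *: f x) x /\
  'D_v (fun x => c x *: f x) x = 'D_v c x *: f x + c x *: 'D_v f x.
Proof.
move=> dc df; have dfi i : differentiable (fun y => f y ord0 i) x.
  by move/differentiable_rowP: df.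
have dcf : differentiable (fun x => c x *: f x) x.
  apply/differentiable_rowP => i; under eq_fun do rewrite mxE.
  exact: differentiableM.
split=> //; apply/rowP => i; rewrite (derive_coord _ _ dcf).
under eq_fun do rewrite mxE; rewrite deriveM; [|exact: diff_derivable..].
by rewrite !mxE (derive_coord _ _ df) addrC; congr (_ + _); exact: mulrC.
Qed.

Lemma Ck_row_mx (R : realType) (V : normedModType R) m1 m2 k (U : set V)
    (f : V -> 'rV[R]_m1) (g : V -> 'rV[R]_m2) : open U ->
  Ck k U f -> Ck k U g -> Ck k U (fun x => row_mx (f x) (g x)).
Proof.
move=> oU /(Ck_rowP _ _ oU) cf /(Ck_rowP _ _ oU) cg; apply/(Ck_rowP _ _ oU) => i.
rewrite -(splitK i); case: (fintype.split i) => j /=.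
  by under eq_fun do rewrite row_mxEl.
by under eq_fun do rewrite row_mxEr.
Qed.

Lemma derive_row_mx (R : realType) (V : normedModType R) m1 m2
    (f : V -> 'rV[R]_m1) (g : V -> 'rV[R]_m2) x v :
  differentiable f x -> differentiable g x ->
  differentiable (fun x => row_mx (f x) (g x)) x /\
  'D_v (fun x => row_mx (f x) (g x)) x = row_mx ('D_v f x) ('D_v g x).
Proof.
move=> df dg; have dfg : differentiable (fun x => row_mx (f x) (g x)) x.
  apply/differentiable_rowP => i; rewrite -(splitK i); case: (fintype.split i) => j /=.
    by under eq_fun do rewrite row_mxEl; move/differentiable_rowP: df.
  by under eq_fun do rewrite row_mxEr; move/differentiable_rowP: dg.
split=> //; apply/rowP => i; rewrite (derive_coord _ _ dfg).
rewrite -(splitK i); case: (fintype.split i) => j /=.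
  by under eq_fun do rewrite row_mxEl; rewrite row_mxEl (derive_coord _ _ df).
by under eq_fun do rewrite row_mxEr; rewrite row_mxEr (derive_coord _ _ dg).
Qed.

Lemma derive_const_mx (R : realType) (V : normedModType R) m
    (c : V -> R) x v : differentiable c x ->
  differentiable (fun x => const_mx (c x) : 'rV[R]_m) x /\
  'D_v (fun x => const_mx (c x) : 'rV[R]_m) x = const_mx ('D_v c x).
Proof.
move=> dc; have d : differentiable (fun x => const_mx (c x) : 'rV[R]_m) x.
  by apply/differentiable_rowP => i; under eq_fun do rewrite mxE.
split=> //; apply/rowP => i; rewrite (derive_coord _ _ d) mxE.
by under eq_fun do rewrite mxE.
Qed.

Lemma Ck_const_mx (R : realType) (V : normedModType R) m k (U : set V)
    (c : V -> R) : open U -> Ck k U c ->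
  Ck k U (fun x => const_mx (c x) : 'rV[R]_m).
Proof. by move=> oU cc; apply/(Ck_rowP _ _ oU) => i; under eq_fun do rewrite mxE. Qed.

Lemma Ck_comp_pair (R : realType) (V : normedModType R) a b m k
    (U' : set V) (U : set ('rV[R]_a * 'rV[R]_b))
    (r1 : V -> 'rV[R]_a) (r2 : V -> 'rV[R]_b) (f : 'rV[R]_a * 'rV[R]_b -> 'rV[R]_m) :
  open U' -> open U -> (forall x, U' x -> U (r1 x, r2 x)) ->
  Ck k U' r1 -> Ck k U' r2 -> Ck k U f -> Ck k U' (fun x => f (r1 x, r2 x)).
Proof.
move=> oU' oU UU' /(Ck_rowP _ _ oU') c1 /(Ck_rowP _ _ oU') c2.
move=> /(Ck_rowP _ _ oU) cf; apply/(Ck_rowP _ _ oU') => i.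
pose bs (j : 'I_a + 'I_b) : 'rV[R]_a * 'rV[R]_b :=
  match j with inl j => (delta_mx ord0 j, 0) | inr j => (0, delta_mx ord0 j) end.
pose cs (j : 'I_a + 'I_b) : V -> R :=
  match j with inl j => fun x => r1 x ord0 j | inr j => fun x => r2 x ord0 j end.
apply: (@Ck_comp _ _ _ _ bs cs k U' U (fun y => f y ord0 i)
  (fun x => (r1 x, r2 x))) => // [x|[j|j]] //.
- rewrite big_sumType /= [RHS]surjective_pairing; congr pair.
    rewrite raddfD !raddf_sum /= [X in _ + X]big1 => [|j _]; last exact: scaler0.
    by rewrite addr0 -row_sum_delta.
  rewrite raddfD !raddf_sum /= [X in X + _]big1 => [|j _]; last exact: scaler0.
  by rewrite add0r -row_sum_delta.
- exact: c1.
- exact: c2.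
Qed.

Lemma derive_pair (R : realType) (V W1 W2 : normedModType R)
    (f : V -> W1) (g : V -> W2) x v :
  differentiable f x -> differentiable g x ->
  'D_v (fun x => (f x, g x)) x = ('D_v f x, 'D_v g x).
Proof.
move=> df dg; rewrite -!derive_diffE //; last exact: differentiable_pair.
by rewrite diff_pair.
Qed.

Lemma continuous_fst (R : realType) (V W : normedModType R) :
  continuous (@fst V W).
Proof. by move=> p; exact: cvg_fst. Qed.

Lemma continuous_snd (R : realType) (V W : normedModType R) :
  continuous (@snd V W).
Proof. by move=> p; exact: cvg_snd. Qed.

Definition normalize (R : realType) m (y : 'rV[R]_m) := (enorm y)^-1 *: y.

Lemma dot_normalize (R : realType) m (y : 'rV[R]_m) : y != 0 ->
  dot (normalize y) (normalize y) = 1.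
Proof.
move=> y0; rewrite dotZl dotZr -sqr_enorm.
by field; rewrite enorm_eq0.
Qed.

Lemma Ck_normalize (R : realType) (V : normedModType R) m k (U : set V)
    (f : V -> 'rV[R]_m) : open U -> (forall x, U x -> f x != 0) ->
  Ck k U f -> Ck k U (fun x => normalize (f x)).
Proof.
move=> oU f0 cf; apply: CkZ => //.
apply: Ck_inv => // [x Ux|]; first by rewrite enorm_gt0 f0.
apply: Ck_sqrt => // [x Ux|]; first by rewrite dot_gt0 f0.
exact: Ck_dot.
Qed.

Lemma derive_normalize (R : realType) (V : normedModType R) m
    (f : V -> 'rV[R]_m) x v : differentiable f x -> f x != 0 ->
  differentiable (fun x => normalize (f x)) x /\
  'D_v (fun x => normalize (f x)) x = (enorm (f x))^-1 *: 'D_v f x -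
    (dot (f x) ('D_v f x) / enorm (f x) ^+ 3) *: f x.
Proof.
move=> df f0; have [de De] := derive_enorm v df f0.
have e0 : enorm (f x) != 0 by rewrite enorm_eq0.
have di : differentiable (fun y => (enorm (f y))^-1) x.
  exact: (differentiableV de).
have [d ->] := deriveZ_row v di df; split=> //.
rewrite deriveV //; last exact: diff_derivable.
rewrite De addrC; congr (_ + _); rewrite -scaleNr; congr (_ *: _).
by rewrite /GRing.scale /=; field.
Qed.

(** * The isometric embedding *)

(** The composite of a local extension with this map depends only on values on [N0], and is defined
    on an open set. At a point of [N0] the differential of the retraction is the orthogonal
    projection onto the tangent space. *)
Definition retract (R : realType) (n : nat) (p : N0_ambient R n) :
  N0_ambient R n := (p.1, normalize p.2).

Lemma retract_N0 (R : realType) (n : nat) (p : N0_ambient R n) :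
  p.2 != 0 -> N0 (retract p).
Proof. by move=> p0; exact: dot_normalize. Qed.

Lemma N0_neq0 (R : realType) (n : nat) (p : N0_ambient R n) :
  N0 p -> p.2 != 0.
Proof. by rewrite /N0 /= => p1; rewrite -dot_eq0 p1 oner_eq0. Qed.

Lemma retract_id (R : realType) (n : nat) (p : N0_ambient R n) :
  N0 p -> retract p = p.
Proof.
case: p => x y /= yy; rewrite /retract /normalize /enorm /=.
by rewrite (_ : dot y y = 1) // sqrtr1 invr1 scale1r.
Qed.

Lemma derive_retract (R : realType) (n : nat) (p w : N0_ambient R n) :
  p.2 != 0 ->
  differentiable (@retract R n) p /\
  'D_w (@retract R n) p = (w.1, (enorm p.2)^-1 *: w.2 -
    (dot p.2 w.2 / enorm p.2 ^+ 3) *: p.2).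
Proof.
move=> p0.
have d1 : differentiable (@fst 'rV[R]_2 'rV[R]_n.-1) p.
  exact/linear_differentiable/continuous_fst.
have d2 : differentiable (@snd 'rV[R]_2 'rV[R]_n.-1) p.
  exact/linear_differentiable/continuous_snd.
have [dn Dn] := derive_normalize w d2 p0.
split; first exact: differentiable_pair.
rewrite derive_pair // Dn.
rewrite (derive_linear (L := @fst 'rV[R]_2 'rV[R]_n.-1)); last exact: continuous_fst.
by rewrite (derive_linear (L := @snd 'rV[R]_2 'rV[R]_n.-1)) //; exact: continuous_snd.
Qed.

Lemma derive_retract_tangent (R : realType) (n : nat) (p w : N0_ambient R n) :
  p.2 != 0 -> N0_tangent (retract p) ('D_w (@retract R n) p).
Proof.
move=> p0; have [_ ->] := derive_retract w p0; rewrite /N0_tangent /=.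
rewrite -scaleNr dotZl dotDr !dotZr -sqr_enorm.
have e0 : enorm p.2 != 0 by rewrite enorm_eq0.
by field.
Qed.

Lemma derive_retract_id (R : realType) (n : nat) (p w : N0_ambient R n) :
  N0 p -> N0_tangent p w -> 'D_w (@retract R n) p = w.
Proof.
move=> Np; rewrite /N0_tangent /= => pw.
have [_ ->] := derive_retract w (N0_neq0 Np).
have -> : enorm p.2 = 1 by rewrite /enorm (_ : dot _ _ = 1) // sqrtr1.
by rewrite pw mul0r scale0r subr0 invr1 scale1r -surjective_pairing.
Qed.

Lemma open_neq0_snd (R : realType) (n : nat) :
  open [set p : N0_ambient R n | p.2 != 0].
Proof.
apply: (@open_comp _ _ (@snd 'rV[R]_2 'rV[R]_n.-1) [set y | y != 0]).
  by move=> p _; exact: continuous_snd.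
have -> : [set y : 'rV[R]_n.-1 | y != 0] = Num.norm @^-1` [set x : R | 0 < x].
  by apply/seteqP; split=> y /=; rewrite normr_gt0.
by apply: open_comp => [y _|]; [exact: norm_continuous|exact: open_gt].
Qed.

Lemma open_retract_preimage (R : realType) (n : nat)
    (U : set (N0_ambient R n)) : open U ->
  open [set p : N0_ambient R n | p.2 != 0 /\ U (retract p)].
Proof.
move=> oU; rewrite openE => p [p0 Up].
have cr : {for p, continuous (@retract R n)}.
  by apply: differentiable_continuous; have [] := derive_retract 0 p0.
rewrite /interior; apply: filterI.
  apply: (@open_nbhs_nbhs _ p [set p | p.2 != 0]).
  by split=> //; exact: open_neq0_snd.
exact: (cr _ (open_nbhs_nbhs (conj oU Up))).
Qed.

Lemma Ck_retract_comp (R : realType) (n m k : nat)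
    (U : set (N0_ambient R n)) (G : N0_ambient R n -> 'rV[R]_m) :
  open U -> Ck k U G ->
  Ck k [set p : N0_ambient R n | p.2 != 0 /\ U (retract p)]
    (fun p => G (retract p)).
Proof.
move=> oU cG; have oD := open_retract_preimage oU.
apply: (@Ck_comp_pair R (N0_ambient R n) 2 n.-1 m k _ U
  (fun p => p.1) (fun p => normalize p.2)) => // [p []//||].
- apply: (@Ck_linear _ _ _ _ _ (@fst 'rV[R]_2 'rV[R]_n.-1)).
  exact: continuous_fst.
- apply: Ck_normalize => // [p []//|].
  apply: (@Ck_linear _ _ _ _ _ (@snd 'rV[R]_2 'rV[R]_n.-1)).
  exact: continuous_snd.
Qed.

Lemma derive_comp_retract (R : realType) (n : nat) (W : normedModType R)
    (H : N0_ambient R n -> W) p w : N0 p -> N0_tangent p w ->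
  differentiable H p -> 'D_w (fun q => H (retract q)) p = 'd H p w.
Proof.
move=> Np Tw dH; have [dr _] := derive_retract w (N0_neq0 Np).
have rp := retract_id Np.
rewrite derive_comp; [|exact: dr|by rewrite rp].
by rewrite rp derive_retract_id // derive_diffE.
Qed.

Lemma local_extension_retract (R : realType) (n : nat) (W : normedModType R)
    (f : N0_ambient R n -> W) U G q :
  local_extension (@N0 R n) f q U G -> forall x,
  x.2 != 0 -> U (retract x) -> G (retract x) = f (retract x).
Proof. by move=> [_ _ _ Gf] x x0 Ux; apply: Gf Ux; exact: retract_N0. Qed.

(** Two extensions may differ off [N0], but composed with the retraction they coincide near p, and
    the differential of the retraction at p fixes tangent vectors. So the differential of a map on
    [N0] is well defined on them. *)
Lemma local_extension_diff (R : realType) (n : nat) (W : normedModType R)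
    (f : N0_ambient R n -> W) p U G U' G' w :
  N0 p -> N0_tangent p w ->
  local_extension (@N0 R n) f p U G -> local_extension (@N0 R n) f p U' G' ->
  'd G p w = 'd G' p w.
Proof.
move=> Np Tw LG LG'; have GE := local_extension_retract LG.
have G'E := local_extension_retract LG'.
have [oU Up cG _] := LG; have [oU' Up' cG' _] := LG'.
have dG : differentiable G p by exact: (cG 1%N).1.
have dG' : differentiable G' p by exact: (cG' 1%N).1.
have p0 := N0_neq0 Np; have rp := retract_id Np.
rewrite -(derive_comp_retract Np Tw dG) -(derive_comp_retract Np Tw dG').
apply: near_eq_derive.
have oI := open_retract_preimage (openI oU oU').
have pI : [set x : N0_ambient R n | x.2 != 0 /\ (U `&` U') (retract x)] p.
  by rewrite /= rp.
apply: filterS (open_nbhs_nbhs (conj oI pI)) => x [x0 [Ux Ux']].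
by rewrite GE // G'E.
Qed.

Lemma dot_const1 (R : realType) (a b : R) :
  dot (const_mx a : 'rV_1) (const_mx b) = a * b.
Proof. by rewrite /dot big_ord1 !mxE. Qed.

Section embedding.
Context (R : realType) (n : nat) (phi ps : R -> R).
Hypothesis (hn : (4 <= n)%N) (hphi : tangherlini_profile n phi).
Hypothesis (cps : Cinfty setT ps) (eps : forall t, ps (- t) = ps t).
Hypothesis (dps : forall t,
  derive1 ps t = derive1 phi t * slope n (mass R n / phi t)).
Hypothesis (psE : forall t, 0 <= t -> psi phi t = ps t).

Local Notation A := (sharp phi).
Local Notation V := (N0_ambient R n).
Local Notation L1 := (@fst 'rV[R]_2 'rV[R]_n.-1).
Local Notation L2 := (@snd 'rV[R]_2 'rV[R]_n.-1).

Lemma sharp_phi_Cinfty : Cinfty setT A.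
Proof. exact/sharp_Cinfty/(phi_Cinfty hphi). Qed.

Lemma sharp_phi_even t : A (- t) = A t.
Proof. exact: sharp_even (phi_derivable hphi) (phi_even hphi). Qed.

Lemma sharp_phiE t : t * A t = derive1 phi t.
Proof. by rewrite sharpE // (dphi_at0 hphi). Qed.

Lemma dsharp_phi_at0 : derive1 A 0 = 0.
Proof.
apply: even_derive10 => [t|]; last exact: sharp_phi_even.
exact/Cinfty_derivable/sharp_phi_Cinfty.
Qed.

Lemma dps_at0 : derive1 ps 0 = 0.
Proof. by rewrite dps (dphi_at0 hphi) mul0r. Qed.

Lemma fN0E : @fN0 R n phi = (fun p : V => row_mx
  (row_mx (const_mx (ps (enorm p.1)) : 'rV[R]_1) (A (enorm p.1) *: p.1))
  (phi (enorm p.1) *: p.2)).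
Proof.
apply/funext => p; rewrite /fN0; congr row_mx; apply/rowP => j.
have H i : derive1 phi (enorm p.1) * (p.1 0 i / enorm p.1) =
    A (enorm p.1) * p.1 0 i.
  rewrite -sharp_phiE; have [x0|x0] := eqVneq p.1 0.
    by rewrite x0 enorm0 mxE !mul0r mulr0.
  by field; rewrite enorm_eq0.
rewrite [RHS]mxE mxE; case: splitP => k ->; rewrite !mxE.
  by rewrite ord1 /= psE ?enorm_ge0.
case: k => -[|[|//]] hk /=; rewrite H; congr (_ * p.1 _ _); exact: val_inj.
Qed.

Lemma fN0_Cinfty : Cinfty setT (@fN0 R n phi).
Proof.
move=> k; have oT : open [set: V] by exact: openT.
have c1 : Ck k setT L1 by apply: Ck_linear; exact: continuous_fst.
have c2 : Ck k setT L2 by apply: Ck_linear; exact: continuous_snd.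
have rad (a : R -> R) : Cinfty setT a -> (forall t, a (- t) = a t) ->
    Ck k setT (fun p : V => a (enorm p.1)).
  by move=> ca ea; apply: (radial_Ck (L := L1)) => //; exact: continuous_fst.
rewrite fN0E; apply: Ck_row_mx => //.
  apply: Ck_row_mx => //.
    by apply: Ck_const_mx => //; exact: rad.
  apply: CkZ => //; apply: rad; [exact: sharp_phi_Cinfty|exact: sharp_phi_even].
apply: CkZ => //; apply: rad; [exact: phi_Cinfty hphi|exact: phi_even hphi].
Qed.

Lemma fN0_derive (p w : V) : 'D_w (@fN0 R n phi) p = row_mx
  (row_mx (const_mx (sharp ps (enorm p.1) * dot p.1 w.1) : 'rV[R]_1)
          ((sharp A (enorm p.1) * dot p.1 w.1) *: p.1 + A (enorm p.1) *: w.1))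
  ((A (enorm p.1) * dot p.1 w.1) *: p.2 + phi (enorm p.1) *: w.2).
Proof.
have d1 : differentiable L1 p by exact/linear_differentiable/continuous_fst.
have d2 : differentiable L2 p by exact/linear_differentiable/continuous_snd.
have D1 : 'D_w L1 p = w.1 by apply: derive_linear; exact: continuous_fst.
have D2 : 'D_w L2 p = w.2 by apply: derive_linear; exact: continuous_snd.
have rad (a : R -> R) : Cinfty setT a -> derive1 a 0 = 0 ->
    differentiable (fun p : V => a (enorm p.1)) p /\
    'D_w (fun p : V => a (enorm p.1)) p = sharp a (enorm p.1) * dot p.1 w.1.
  move=> ca ea; apply: (radial_differentiable (L := L1)) => //.
  exact: continuous_fst.
have [dr1 Dr1] := rad _ cps dps_at0.
have [dr2 Dr2] := rad _ sharp_phi_Cinfty dsharp_phi_at0.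
have [dr3 Dr3] := rad _ (phi_Cinfty hphi) (dphi_at0 hphi).
have [e1 E1] := @derive_const_mx _ _ 1 _ _ w dr1.
have [e2 E2] := deriveZ_row w dr2 d1.
have [e3 E3] := deriveZ_row w dr3 d2.
have [e4 E4] := derive_row_mx w e1 e2.
have [e5 E5] := derive_row_mx w e4 e3.
by rewrite fN0E E5 E4 E3 E2 E1 Dr1 Dr2 Dr3 D1 D2.
Qed.

Lemma d2phi_sharp t : derive1 (derive1 phi) t = A t + t ^+ 2 * sharp A t.
Proof.
have -> : derive1 phi = fun t => t * A t by apply/funext => s; rewrite sharp_phiE.
have dA : is_derive t 1 A (derive1 A t).
  rewrite derive1E; apply: derivableP.
  exact/Cinfty_derivable/sharp_phi_Cinfty.
rewrite derive1E; have [_ ->] := is_deriveM (is_derive_id t 1) dA.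
rewrite -(sharpE _ dsharp_phi_at0) /GRing.scale /= mulr1 addrC expr2.
by rewrite mulrA.
Qed.

(** Lagrange's identity in the plane, polarized: it converts the dtheta^2 part of the metric into
    inner products. *)
Lemma lagrange2 (x u v : 'rV[R]_2) :
  (x 0 0 * u 0 1 - x 0 1 * u 0 0) * (x 0 0 * v 0 1 - x 0 1 * v 0 0) =
  dot x x * dot u v - dot x u * dot x v.
Proof.
have dE (a b : 'rV[R]_2) : dot a b = a 0 0 * b 0 0 + a 0 1 * b 0 1.
  rewrite /dot !big_ord_recl big_ord0 addr0; congr (_ + a _ _ * b _ _);
  exact: val_inj.
by rewrite !dE; ring.
Qed.

(** At x = 0 the terms in <x, w.1> vanish and A(0) = phi''(0) = 1. Elsewhere both sides are
    multiplied by t^2 and compared as combinations of <x, w.1> <x, w'.1>, <w.1, w'.1> and <w.2,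
    w'.2>. *)
Lemma fN0_isometry (p w w' : V) : N0 p -> N0_tangent p w -> N0_tangent p w' ->
  dot ('D_w (@fN0 R n phi) p) ('D_w' (@fN0 R n phi) p) = gN0 phi p w w'.
Proof.
rewrite /N0 /N0_tangent /= => yy yw yw'.
have wy : dot w.2 p.2 = 0 by rewrite dotC.
rewrite !fN0_derive (@dot_row R 3 n.-1) (@dot_row R 1 2) dot_const1.
rewrite !(dotDl, dotDr, dotZl, dotZr) yy yw' wy (dotC w.1 p.1) /gN0 /gL0.
have [x0|x0] := eqVneq p.1 0.
  by rewrite x0 enorm0 !dot0l (sharp_phi_at0 hn hphi); ring.
set t := enorm p.1; have t0 : t != 0 by rewrite enorm_eq0.
have tt : dot p.1 p.1 = t ^+ 2 by rewrite sqr_enorm.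
rewrite /dt /dtheta -/t -sharp_phiE tt.
set r := dot p.1 w.1; set r' := dot p.1 w'.1.
have -> a b : a / t ^+ 2 * (b / t ^+ 2) = a * b / t ^+ 4 by field.
rewrite lagrange2 tt -/r -/r'.
have E := sqr_psi_slope hn hphi t.
(* The identity for psi'^2 is put in terms of psi' = t [sharp ps], phi' = t A and phi'' = A + t^2
   [sharp A], the quantities that occur in the derivative of the map. It matches the coefficients of
   <x, w.1> <x, w'.1>. *)
rewrite -dps -(sharpE _ dps_at0) d2phi_sharp -sharp_phiE in E.
apply: (mulfI (x := t ^+ 2)); first by rewrite expf_neq0.
rewrite (_ : t ^+ 2 * (r / t * _ + _ + _) = r * r' * (1 - A t ^+ 2) +
  t ^+ 2 * (A t ^+ 2 * dot w.1 w'.1 + phi t ^+ 2 * dot w.2 w'.2)); last by field.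
rewrite (_ : 1 - A t ^+ 2 = (t * sharp ps t) ^+ 2 +
  (A t + t ^+ 2 * sharp A t) ^+ 2 + (t * A t) ^+ 2 - A t ^+ 2); last first.
  by rewrite E; ring.
move: (sharp ps t) (A t) (sharp A t) (phi t) (dot w.1 w'.1) (dot w.2 w'.2) => *.
by clear; ring.
Qed.

End embedding.

Section fN0_embedding.
Context (R : realType) (n : nat) (phi : R -> R).
Hypothesis (hn : (4 <= n)%N) (hphi : tangherlini_profile n phi).

Local Notation A := (sharp phi).
Local Notation V := (N0_ambient R n).

Lemma fN0_smooth : Cinfty setT (@fN0 R n phi).
Proof.
by have [ps [cps eps dps psE]] := psi_smooth hn hphi; exact: (fN0_Cinfty hphi cps).
Qed.

Lemma fN0_differentiable (p : V) : differentiable (@fN0 R n phi) p.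
Proof. exact: (fN0_smooth 1%N).1. Qed.

Lemma fN0_diff_isometry (p w w' : V) :
  N0 p -> N0_tangent p w -> N0_tangent p w' ->
  dot ('d (@fN0 R n phi) p w) ('d (@fN0 R n phi) p w') = gN0 phi p w w'.
Proof.
have [ps [cps eps dps psE]] := psi_smooth hn hphi.
move=> Np Tw Tw'; rewrite !derive_diffE; [|exact: fN0_differentiable..].
exact: (fN0_isometry hn hphi cps dps psE).
Qed.

(** Pairing the last block with y isolates A <x, w.1>, as |y| = 1 and w.2 is orthogonal to y. Since
    A > 0 this forces <x, w.1> = 0, and then A w.1 = 0 and phi w.2 = 0 remain. *)
Lemma fN0_immersion (p w : V) : N0 p -> N0_tangent p w ->
  'd (@fN0 R n phi) p w = 0 -> w = 0.
Proof.
have [ps [cps eps dps psE]] := psi_smooth hn hphi.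
rewrite /N0 /N0_tangent /= => yy yw; rewrite derive_diffE; last exact: fN0_differentiable.
rewrite (fN0_derive hphi cps dps psE).
rewrite -[0 in RHS](@row_mx0 R 1 3 n.-1) => /eq_row_mx[E1 E2].
have {}E1 := congr1 (@rsubmx R 1 1 2) E1; rewrite row_mxKr linear0 in E1.
have r0 : dot p.1 w.1 = 0.
  have := congr1 (dot p.2) E2; rewrite dotDr !dotZr dot0r yy yw mulr0 addr0 mulr1.
  move/eqP; rewrite mulf_eq0 gt_eqF; first by move/eqP.
  exact: sharp_phi_gt0 hn hphi _.
move: E1 E2; rewrite r0 !mulr0 !scale0r !add0r => /eqP E1 /eqP E2.
rewrite [w]surjective_pairing; congr pair; apply/eqP.
  by move: E1; rewrite scaler_eq0 gt_eqF //; exact: sharp_phi_gt0 hn hphi _.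
by move: E2; rewrite scaler_eq0 gt_eqF //; exact: phi_gt0 hn hphi _.
Qed.

(** Outside the range of phi' the value is a default; continuity is claimed only along the image of
    the embedding. *)
Definition dphi_inv (s : R) : R := xget 0 [set t | derive1 phi t = s].

Lemma dphi_invK (t : R) : dphi_inv (derive1 phi t) = t.
Proof.
rewrite /dphi_inv; case: xgetP => [u _ /= E|/(_ t) []//].
have [ut|tu|//] := ltgtP u t.
  by have := dphi_incr hn hphi ut; rewrite E ltxx.
by have := dphi_incr hn hphi tu; rewrite E ltxx.
Qed.

Definition fN0_mid (z : 'rV[R]_(3 + n.-1)) : 'rV[R]_2 :=
  rsubmx (lsubmx z : 'rV[R]_(1 + 2)).

Definition fN0_inv (z : 'rV[R]_(3 + n.-1)) : V :=
  ((A (dphi_inv (enorm (fN0_mid z))))^-1 *: fN0_mid z, normalize (rsubmx z)).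

Lemma fN0_midE (p : V) : fN0_mid (fN0 phi p) = A (enorm p.1) *: p.1.
Proof.
have [ps [cps eps dps psE]] := psi_smooth hn hphi.
by rewrite (fN0E hphi psE) /fN0_mid row_mxKl (@row_mxKr R 1 1 2).
Qed.

Lemma enorm_fN0_mid (p : V) :
  enorm (fN0_mid (fN0 phi p)) = derive1 phi (enorm p.1).
Proof.
rewrite fN0_midE enormZ gtr0_norm ?(sharp_phi_gt0 hn hphi) //.
by rewrite mulrC (sharp_phiE hphi).
Qed.

Lemma fN0K (p : V) : N0 p -> fN0_inv (fN0 phi p) = p.
Proof.
move=> Np; rewrite /fN0_inv enorm_fN0_mid dphi_invK fN0_midE scalerA mulVf; last first.
  by rewrite gt_eqF // (sharp_phi_gt0 hn hphi).
rewrite scale1r [RHS]surjective_pairing; congr pair.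
rewrite /fN0 row_mxKr /normalize enormZ gtr0_norm ?(phi_gt0 hn hphi) //.
have -> : enorm p.2 = 1 by rewrite /enorm (_ : dot _ _ = 1) // sqrtr1.
by rewrite mulr1 scalerA mulVf ?scale1r // (phi_neq0 hn hphi).
Qed.

Lemma continuous_enorm m : continuous (@enorm R m).
Proof.
move=> u; apply: (@continuous_comp _ _ _ (fun u : 'rV[R]_m => dot u u) Num.sqrt).
  apply/differentiable_continuous/(@differentiable_dot R _ m id id).
    exact: ex_diff.
  exact: ex_diff.
exact: sqrt_continuous.
Qed.

Lemma continuous_fN0_mid : continuous fN0_mid.
Proof.
move=> z; apply: (@continuous_comp _ _ _ (fun z => lsubmx z : 'rV[R]_(1 + 2)) (@rsubmx R 1 1 2)).
  exact/differentiable_continuous/differentiable_lsubmx.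
exact/differentiable_continuous/differentiable_rsubmx.
Qed.

Lemma fN0_inv_continuous : {within fN0 phi @` @N0 R n, continuous fN0_inv}.
Proof.
apply/subspace_continuousP => z0 [p0 Np0 <-{z0}].
set S := fN0 phi @` @N0 R n; set z0 := fN0 phi p0; set t0 := enorm p0.1.
have cmid : fN0_mid z @[z --> within S (nbhs z0)] --> fN0_mid z0.
  by apply: cvg_within_filter; exact: continuous_fN0_mid.
have cemid : enorm (fN0_mid z) @[z --> within S (nbhs z0)] --> derive1 phi t0.
  rewrite -enorm_fN0_mid; apply: cvg_comp cmid _; exact: continuous_enorm.
(* phi' increases strictly on the whole line, so the bracket at t0 - e makes sense even when that
   number is negative. Points of S give norms in the range of phi', where the radius is recovered
   exactly. *)
have cinv : dphi_inv (enorm (fN0_mid z)) @[z --> within S (nbhs z0)] --> t0.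
  apply/cvgrPdist_lt => e e0.
  have lo : derive1 phi (t0 - e) < derive1 phi t0.
    by apply: dphi_incr hn hphi _ _ _; rewrite ltrBlDr ltrDl.
  have hi : derive1 phi t0 < derive1 phi (t0 + e).
    by apply: dphi_incr hn hphi _ _ _; rewrite ltrDl.
  have FF : Filter (within S (nbhs z0)) by exact: within_filter.
  have near_lo : \forall z \near within S (nbhs z0),
      derive1 phi (t0 - e) < enorm (fN0_mid z) by exact: (cvgr_gt _ cemid _ lo).
  have near_hi : \forall z \near within S (nbhs z0),
      enorm (fN0_mid z) < derive1 phi (t0 + e) by exact: (cvgr_lt _ cemid _ hi).
  have nS : \forall z \near within S (nbhs z0), S z by exact: withinT.
  apply: filterS3 near_lo near_hi nS => z lz hz [p Np zE].
  rewrite -zE enorm_fN0_mid dphi_invK.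
  have l : derive1 phi (t0 - e) < derive1 phi (enorm p.1).
    by rewrite -enorm_fN0_mid zE.
  have h : derive1 phi (enorm p.1) < derive1 phi (t0 + e).
    by rewrite -enorm_fN0_mid zE.
  rewrite distrC ltr_distl; apply/andP; split.
    rewrite ltNge; apply/negP; rewrite le_eqVlt => /predU1P[E|E].
      by move: l; rewrite E ltxx.
    by have := lt_trans l (dphi_incr hn hphi E); rewrite ltxx.
  rewrite ltNge; apply/negP; rewrite le_eqVlt => /predU1P[E|E].
    by move: h; rewrite E ltxx.
  by have := lt_trans h (dphi_incr hn hphi E); rewrite ltxx.
have c1 : (A (dphi_inv (enorm (fN0_mid z))))^-1 *: fN0_mid z
    @[z --> within S (nbhs z0)] --> (fN0_inv z0).1.
  apply: cvgZ => //; rewrite enorm_fN0_mid dphi_invK.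
  apply: cvgV; first by rewrite gt_eqF // (sharp_phi_gt0 hn hphi).
  apply: cvg_comp cinv _; exact/Cinfty_continuous/(sharp_phi_Cinfty hphi).
have c2 : normalize (rsubmx z) @[z --> within S (nbhs z0)] --> (fN0_inv z0).2.
  apply: cvg_within_filter.
  have y0 : rsubmx z0 != 0.
    rewrite /z0 /fN0 row_mxKr scaler_eq0 negb_or (phi_neq0 hn hphi) //=.
    exact: N0_neq0.
  have [d _] := derive_normalize 0 (@differentiable_rsubmx R 1 3 n.-1 z0) y0.
  exact: (differentiable_continuous d).
exact: (cvg_pair c1 c2).
Qed.

Lemma fN0_local_extension (p : V) : local_extension (@N0 R n) (fN0 phi) p setT (fN0 phi).
Proof. by split=> //; [exact: openT|exact: fN0_smooth]. Qed.

Lemma fN0_isometric_embedding :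
  isometric_embedding (@N0 R n) (@N0_tangent R n) (gN0 phi) (fN0 phi).
Proof.
split.
  split.
  - by move=> p Np; exists setT, (fN0 phi); exact: fN0_local_extension.
  - move=> p U G Np LG w Tw.
    rewrite (local_extension_diff Np Tw LG (fN0_local_extension p)).
    exact: fN0_immersion.
  - exists fN0_inv; split; [exact: fN0K|exact: fN0_inv_continuous].
move=> p U G Np LG w w' Tw Tw'.
apply: etrans (fN0_diff_isometry Np Tw Tw'); apply: f_equal2.
  exact: local_extension_diff Np Tw LG (fN0_local_extension p).
exact: local_extension_diff Np Tw' LG (fN0_local_extension p).
Qed.

End fN0_embedding.

(** * The image as a submanifold *)

(** Half of the gnomonic chart of the sphere: v is placed in the hyperplane y_j = s, with s a sign,
    and normalizing then covers the open hemisphere s y_j > 0. *)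
Definition insert (R : realType) m (j : 'I_m.+1) (s : R) (v : 'rV[R]_m) :
  'rV[R]_m.+1 := \row_i (if unlift j i is Some k then v ord0 k else s).

Lemma insert_same (R : realType) m (j : 'I_m.+1) (s : R) (v : 'rV[R]_m) :
  insert j s v ord0 j = s.
Proof. by rewrite mxE unlift_none. Qed.

Lemma insert_lift (R : realType) m (j : 'I_m.+1) (s : R) (v : 'rV[R]_m) k :
  insert j s v ord0 (lift j k) = v ord0 k.
Proof. by rewrite mxE liftK. Qed.

Lemma insert_neq0 (R : realType) m (j : 'I_m.+1) (s : R) (v : 'rV[R]_m) :
  s != 0 -> insert j s v != 0.
Proof.
apply: contraNneq => E; have := congr1 (fun u : 'rV[R]_m.+1 => u ord0 j) E.
by rewrite insert_same mxE => ->.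
Qed.

Lemma Ck_insert (R : realType) (V : normedModType R) m k (U : set V)
    (j : 'I_m.+1) (s : R) (f : V -> 'rV[R]_m) : open U -> Ck k U f ->
  Ck k U (fun x => insert j s (f x)).
Proof.
move=> oU /(Ck_rowP _ _ oU) cf; apply/(Ck_rowP _ _ oU) => i.
under eq_fun do rewrite mxE; case: (unlift j i) => [l|]; first exact: cf.
exact: Ck_cst.
Qed.

Lemma derive_insert (R : realType) (V : normedModType R) m
    (j : 'I_m.+1) (s : R) (f : V -> 'rV[R]_m) x v : differentiable f x ->
  differentiable (fun x => insert j s (f x)) x /\
  'D_v (fun x => insert j s (f x)) x = insert j 0 ('D_v f x).
Proof.
move=> df; have d : differentiable (fun x => insert j s (f x)) x.
  apply/differentiable_rowP => i; under eq_fun do rewrite mxE.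
  case: (unlift j i) => [l|]; last exact: differentiable_cst.
  by move/differentiable_rowP: df.
split=> //; apply/rowP => i; rewrite (derive_coord _ _ d) mxE.
under eq_fun do rewrite mxE.
by case: (unlift j i) => [l|]; [rewrite (derive_coord _ _ df)|exact: derive_cst].
Qed.

(** The inverse gnomonic chart: y is rescaled until its coordinate j equals s, which for s^2 = 1
    means dividing by s y_j. *)
Definition project (R : realType) m (j : 'I_m.+1) (s : R) (y : 'rV[R]_m.+1) :
  'rV[R]_m := \row_i (y ord0 (lift j i) / (s * y ord0 j)).

Lemma projectK (R : realType) m (j : 'I_m.+1) (s : R) (y : 'rV[R]_m.+1) :
  s * s = 1 -> 0 < s * y ord0 j -> dot y y = 1 ->
  normalize (insert j s (project j s y)) = y.
Proof.
move=> ss sy yy; set c := s * y ord0 j.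
have -> : insert j s (project j s y) = c^-1 *: y.
  apply/rowP => i; rewrite !mxE; case: unliftP => [l ->|->].
    by rewrite mxE mulrC.
  have s0 : s != 0 by apply: contraTneq sy => ->; rewrite mul0r ltxx.
  have y0 : y ord0 j != 0 by apply: contraTneq sy => ->; rewrite mulr0 ltxx.
  apply: (mulfI s0); rewrite ss /c invfM; field; exact/andP.
rewrite /normalize enormZ gtr0_norm ?invr_gt0 //.
rewrite /enorm yy sqrtr1 mulr1 invrK scalerA divff ?scale1r //.
by rewrite gt_eqF.
Qed.

Lemma insertK (R : realType) m (j : 'I_m.+1) (s : R) (v : 'rV[R]_m) :
  s * s = 1 -> project j s (normalize (insert j s v)) = v.
Proof.
move=> ss; have s0 : s != 0 by apply: contra_eq_neq ss => ->; rewrite mul0r eq_sym oner_eq0.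
apply/rowP => i; rewrite mxE 2![(normalize _) _ _]mxE insert_lift insert_same.
have e0 : enorm (insert j s v) != 0 by rewrite enorm_eq0 insert_neq0.
rewrite [s * (_ * _)]mulrCA ss mulr1 mulrAC divff ?mul1r //.
by rewrite invr_eq0.
Qed.

Lemma project_differentiable (R : realType) m (j : 'I_m.+1) (s : R)
    (y : 'rV[R]_m.+1) : s * y ord0 j != 0 -> differentiable (project j s) y.
Proof.
move=> sy; apply/differentiable_rowP => i; under eq_fun do rewrite mxE.
have dc k : differentiable (fun y : 'rV[R]_m.+1 => y ord0 k) y.
  exact: differentiable_coord.
apply: differentiableM => //; apply: differentiableV => //.
exact: (differentiableM (differentiable_cst s y) (dc j)).
Qed.

Section fN0_submanifold.
Context (R : realType) (m : nat) (phi : R -> R).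
Local Notation n := m.+4.
Hypothesis hphi : tangherlini_profile n phi.

Let hn : (4 <= n)%N. Proof. by []. Qed.

Local Notation V := (N0_ambient R n).

(** [2 + m.+2] computes to [n], so the parameters have the right dimension; [n] is written [m.+4]
    because [insert] needs a successor as target dimension. The values lie off [N0] in general and
    are brought there by [retract]. *)
Definition sphere_chart (j : 'I_m.+3) (s : R) (z : 'rV[R]_(2 + m.+2)) : V :=
  (lsubmx z, insert j s (rsubmx z)).

Lemma chart_differentiable j s (z v : 'rV[R]_(2 + m.+2)) :
  differentiable (sphere_chart j s) z /\
  'D_v (sphere_chart j s) z = (lsubmx v, insert j 0 (rsubmx v)).
Proof.
have dl : differentiable (@lsubmx R 1 2 m.+2) z by exact: differentiable_lsubmx.
have dr : differentiable (@rsubmx R 1 2 m.+2) z by exact: differentiable_rsubmx.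
have [di Di] := derive_insert j s v dr.
split; first exact: differentiable_pair.
rewrite derive_pair // Di; congr pair; last congr insert.
  by apply: derive_linear => u; exact/differentiable_continuous/differentiable_lsubmx.
by apply: derive_linear => u; exact/differentiable_continuous/differentiable_rsubmx.
Qed.

Lemma sphere_chart_neq0 j s z : s != 0 -> (sphere_chart j s z).2 != 0.
Proof. exact: insert_neq0. Qed.

Lemma chart_Ck k j s : s != 0 ->
  Ck k setT (fun z => @fN0 R n phi (retract (sphere_chart j s z))).
Proof.
move=> s0; have oT : open [set: 'rV[R]_(2 + m.+2)] by exact: openT.
apply: (@Ck_comp_pair R 'rV[R]_(2 + m.+2) 2 m.+3 _ k _ setT
  (fun z => lsubmx z) (fun z => normalize (insert j s (rsubmx z)))) => //.
- exact: openT.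
- apply: (@Ck_linear _ _ _ _ _ (@lsubmx R 1 2 m.+2)) => u.
  exact/differentiable_continuous/differentiable_lsubmx.
- apply: Ck_normalize => // [z _|]; first exact: insert_neq0.
  apply: Ck_insert => //; apply: (@Ck_linear _ _ _ _ _ (@rsubmx R 1 2 m.+2)) => u.
  exact/differentiable_continuous/differentiable_rsubmx.
- exact: (fN0_smooth hn hphi).
Qed.

Lemma chart_immersion j s z v : s != 0 ->
  'd (fun z => @fN0 R n phi (retract (sphere_chart j s z))) z v = 0 -> v = 0.
Proof.
move=> s0; set h := (fun z => _).
have dh : differentiable h z by exact: (chart_Ck 1 j s0).1.
have q0 := sphere_chart_neq0 j z s0.
have [dc Dc] := chart_differentiable j s z v.
have [drt Drt] := derive_retract ('D_v (sphere_chart j s) z) q0.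
have dcr : differentiable (fun z => retract (sphere_chart j s z)) z.
  exact: (differentiable_comp dc drt).
rewrite derive_diffE // /h derive_comp //; last exact: fN0_differentiable hn hphi _.
rewrite -derive_diffE; last exact: fN0_differentiable hn hphi _.
rewrite derive_comp // => /(fN0_immersion hn hphi (retract_N0 q0)).
move=> /(_ (derive_retract_tangent _ q0)); rewrite Drt Dc /= => -[E1 E2].
have e0 : enorm (insert j s (rsubmx z)) != 0 by rewrite enorm_eq0.
move: E2; set c := (dot _ _ / _) => E2.
(* Coordinate j of the chart is constant, so at j the equation reads - c s = 0: the radial
   correction vanishes. *)
have c0 : c = 0.
  move/rowP: (E2) => /(_ j); rewrite !mxE unlift_none mulr0 add0r => /eqP.
  by rewrite oppr_eq0 mulf_eq0 (negbTE s0) orbF => /eqP.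
rewrite -[v]hsubmxK E1 -[RHS](@row_mx0 R 1 2 m.+2); congr row_mx.
apply/rowP => i; rewrite mxE; move/rowP: E2 => /(_ (lift j i)).
rewrite c0 scale0r subr0 !mxE liftK => /eqP.
by rewrite mulf_eq0 invr_eq0 (negbTE e0) /= mxE => /eqP.
Qed.

Lemma fN0_image_submanifold : submanifold n (fN0 phi @` @N0 R n).
Proof.
move=> z0 [p0 Np0 <-]; have y0 := N0_neq0 Np0.
have /existsP[j yj] : [exists j, p0.2 ord0 j != 0].
  apply: contraNT y0; rewrite negb_exists => /forallP H.
  by apply/eqP/rowP => j; rewrite mxE; apply/eqP; rewrite -[_ == _]negbK H.
(* The sign s selects the hemisphere containing p0. As phi > 0, this hemisphere is cut out on the
   image by an open condition on the last block. *)
pose s := Num.sg (p0.2 ord0 j).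
have ss : s * s = 1 by rewrite -expr2 sqr_sg yj.
have s0 : s != 0 by rewrite sgr_eq0.
pose yof (z : 'rV[R]_(3 + m.+3)) := s * rsubmx z ord0 j.
have yofE (p : V) : yof (fN0 phi p) = phi (enorm p.1) * (s * p.2 ord0 j).
  by rewrite /yof /fN0 row_mxKr mxE mulrCA.
have phi0 t : 0 < phi t by exact: phi_gt0 hn hphi t.
have sy_gt0 (p : V) : 0 < yof (fN0 phi p) -> 0 < s * p.2 ord0 j.
  by rewrite yofE -(pmulr_rgt0 (s * p.2 ord0 j) (phi0 (enorm p.1))).
pose h z := @fN0 R n phi (retract (sphere_chart j s z)).
pose kk z : 'rV[R]_(2 + m.+2) :=
  row_mx (@fN0_inv R n phi z).1 (project j s (@fN0_inv R n phi z).2).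
have cyof : continuous yof.
  move=> z; apply/differentiable_continuous/differentiableM.
    exact: differentiable_cst.
  apply: (@differentiable_comp _ _ _ _ (@rsubmx R 1 3 m.+3)
    (fun y : 'rV[R]_m.+3 => y ord0 j)); first exact: differentiable_rsubmx.
  exact: differentiable_coord.
have hE z : h z = fN0 phi (retract (sphere_chart j s z)) by [].
have Nh z : N0 (retract (sphere_chart j s z)).
  by apply: retract_N0; exact: sphere_chart_neq0.
exists [set z | 0 < yof z], setT, h, kk; split.
- split; last by rewrite /= yofE mulr_gt0 //; rewrite /s -normrEsg normr_gt0.
  apply: (@open_comp _ _ yof [set r : R | 0 < r]) => [z _|]; last exact: open_gt.
  exact: cyof.
- split; first exact: openT.
  apply/seteqP; split=> [_ [z _ <-]|_ [[p Np <-] /= up]].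
    split; first by exists (retract (sphere_chart j s z)).
    rewrite /= hE yofE mulr_gt0 //= mxE insert_same mulrCA ss mulr1.
    by rewrite invr_gt0 enorm_gt0 insert_neq0.
  exists (row_mx p.1 (project j s p.2)) => //.
  have -> : h (row_mx p.1 (project j s p.2)) =
      @fN0 R n phi (p.1, normalize (insert j s (project j s p.2))).
    by rewrite hE /retract /sphere_chart row_mxKl row_mxKr.
  have sy : 0 < s * p.2 ord0 j by exact: sy_gt0.
  by rewrite projectK // -surjective_pairing.
- by move=> k; exact: chart_Ck.
- by move=> z v _; exact: chart_immersion.
split=> [z _|].
  rewrite /kk hE (fN0K hn hphi (Nh z)) /=.
  rewrite insertK //; exact: (@hsubmxK R 1 2 m.+2 z).
have /subspace_continuousP ck := fN0_inv_continuous hn hphi.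
apply/subspace_continuousP => _ [[p Np <-] /= up].
set S := _ `&` _; set z1 := fN0 phi p.
have cS : @fN0_inv R n phi z @[z --> within S (nbhs z1)] --> @fN0_inv R n phi z1.
  have /ck : (fN0 phi @` @N0 R n) z1 by exists p.
  by apply: cvg_trans; apply: cvg_app; apply: within_subset => z [].
apply: (@cvg_comp _ _ _ (@fN0_inv R n phi)
  (fun q : V => row_mx q.1 (project j s q.2)) _ _ _ cS).
rewrite /from_subspace /kk fN0K //.
have d1 : differentiable (@fst 'rV[R]_2 'rV[R]_m.+3) p.
  exact/linear_differentiable/continuous_fst.
have d2 : differentiable (@snd 'rV[R]_2 'rV[R]_m.+3) p.
  exact/linear_differentiable/continuous_snd.
have dp : differentiable (project j s) p.2.
  apply: project_differentiable; rewrite gt_eqF //.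
  exact: sy_gt0.
have [d _] := derive_row_mx 0 d1 (differentiable_comp d2 dp).
exact: (differentiable_continuous d).
Qed.

End fN0_submanifold.

(** * Second derivatives and the Gauss equation *)

Lemma is_derive_line (R : realType) (V : normedModType R) (f : V -> R)
    (y u : V) (a : R) : differentiable f (y + a *: u) ->
  is_derive a 1 (fun a : R => f (y + a *: u)) ('D_u f (y + a *: u)).
Proof.
move=> df.
have di : differentiable (@id R) a by exact: ex_diff.
have ds : differentiable (fun a : R => a *: u) a by exact: (@differentiableZl R R V id u a di).
have dc : differentiable (fun _ : R => y) a by exact: differentiable_cst.
have dl : differentiable (fun a : R => y + a *: u) a by exact: differentiableD.
have Ds : 'D_1 (fun a : R => a *: u) a = u.
  rewrite -derive_diffE // (@diffZl R R V id u a di) derive_diffE // derive_id.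
  exact: scale1r.
have Dl : 'D_1 (fun a : R => y + a *: u) a = u.
  rewrite deriveD; [|exact: diff_derivable..].
  by rewrite derive_cst add0r.
split.
  apply/derivable1_diffP.
  exact: (@differentiable_comp _ _ _ _ (fun a : R => y + a *: u) f).
by rewrite (derive_comp (r := fun a : R => y + a *: u) (f := f)) // Dl.
Qed.

(** The mean value theorem twice: along u for the difference of f between two opposite sides of the
    parallelogram, then along v for ['D_u f]. *)
Lemma second_difference_mvt (R : realType) (V : normedModType R) (f : V -> R)
    (U : set V) (x u v : V) (s : R) : Ck 2 U f ->
  (forall a b, 0 <= a <= 1 -> 0 <= b <= 1 ->
    U (x + (a * s) *: u + (b * s) *: v)) ->
  exists a b, [/\ 0 <= a <= 1, 0 <= b <= 1 &
    f (x + s *: u + s *: v) - f (x + s *: u) - f (x + s *: v) + f x =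
    'D_v ('D_u f) (x + (a * s) *: u + (b * s) *: v) * s * s].
Proof.
move=> [df Df] HU; have i0 : 0 <= (0 : R) <= 1 by rewrite lexx ler01.
have i1 : 0 <= (1 : R) <= 1 by rewrite lexx ler01.
have Eu a b : x + (a * s) *: u + (b * s) *: v = x + (b * s) *: v + (a * s) *: u.
  by rewrite addrAC.
pose G (a : R) : R := f (x + s *: v + a *: u) - f (x + a *: u).
have Gd (a : R) : 0 <= a <= 1 -> is_derive (a * s) 1 G
    ('D_u f (x + s *: v + (a * s) *: u) - 'D_u f (x + (a * s) *: u)).
  move=> a01; apply: is_deriveB; apply: is_derive_line; apply: df.
    by have := HU a 1 a01 i1; rewrite mul1r addrAC.
  by have := HU a 0 a01 i0; rewrite mul0r scale0r addr0.
have [a a01|a a01 GE] := @mvt_origin R G s; first by have [] := Gd a a01.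
pose H (b : R) : R := 'D_u f (x + (a * s) *: u + b *: v).
have Hd (b : R) : 0 <= b <= 1 -> is_derive (b * s) 1 H
    ('D_v ('D_u f) (x + (a * s) *: u + (b * s) *: v)).
  by move=> b01; apply: is_derive_line; apply: (Df u).1; exact: HU.
have [b b01|b b01 HE] := @mvt_origin R H s; first by have [] := Hd b b01.
exists a, b; split=> //.
have [_ DH] := Hd b b01; have [_ DG] := Gd a a01.
rewrite -DH -derive1E -HE.
have -> : H s - H 0 = derive1 G (a * s).
  by rewrite derive1E DG /H scale0r addr0; congr ('D_u f _ - _); rewrite addrAC.
rewrite -GE /G !scale0r !addr0 [x + s *: v + s *: u]addrAC.
by rewrite opprD opprK addrA.
Qed.

Lemma dist_le_common (R : realType) (p q z z' e : R) : z = z' ->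
  `|p - z| < e / 2 -> `|q - z'| < e / 2 -> `|p - q| <= e.
Proof.
move=> -> pz qz; rewrite -(subrKA z') (le_trans (ler_normD _ _)) //.
by rewrite (splitr e) lerD // ltW // distrC.
Qed.

(** The second difference over a parallelogram is symmetric in u and v, and equals s^2 times either
    mixed derivative at some point of it; continuity of both at x concludes. *)
Lemma derive_swap (R : realType) (V : normedModType R) (f : V -> R)
    (U : set V) (x u v : V) : open U -> Ck 2 U f -> U x ->
  'D_v ('D_u f) x = 'D_u ('D_v f) x.
Proof.
move=> oU cf Ux; apply/eqP; rewrite -subr_eq0 -normr_eq0.
have cD u' v' : {for x, continuous ('D_v' ('D_u' f))}.
  by have [_ /(_ u') [_ /(_ v')]] := cf; apply.
rewrite eq_le normr_ge0 andbT; apply/ler_addgt0Pl => e e0; rewrite addr0.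
have e20 : 0 < e / 2 by rewrite divr_gt0.
have /cvgrPdist_lt /(_ _ e20) n1 := cD u v.
have /cvgrPdist_lt /(_ _ e20) n2 := cD v u.
have nU : \forall y \near x, U y by exact: (open_nbhs_nbhs (conj oU Ux)).
have nB : \forall y \near x, [/\ U y,
    `|'D_v ('D_u f) x - 'D_v ('D_u f) y| < e / 2 &
    `|'D_u ('D_v f) x - 'D_u ('D_v f) y| < e / 2].
  apply: filterS3 nU n1 n2 => y h1 h2 h3; exact: (And3 h1 h2 h3).
have {nB} [d /= d0 B] := (nbhs_ballP _ _).1 nB.
(* The scale s keeps the parallelogram inside the ball of radius d; the 1 in c covers u = v = 0. *)
pose c := `|u| + `|v| + 1; have c0 : 0 < c by rewrite ltr_wpDl // addr_ge0.
pose s := d / 2 / c; have s0 : 0 < s by rewrite !divr_gt0.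
have inB a b : 0 <= a <= 1 -> 0 <= b <= 1 ->
    ball x d (x + (a * s) *: u + (b * s) *: v).
  move=> /andP[a0 a1] /andP[b0 b1]; rewrite -ball_normE /=.
  rewrite -addrA opprD addNKr normrN.
  have as0 : 0 <= a * s by rewrite mulr_ge0 // ltW.
  have bs0 : 0 <= b * s by rewrite mulr_ge0 // ltW.
  apply: le_lt_trans (ler_normD _ _) _.
  rewrite (normrZ _ u) (normrZ _ v) (ger0_norm as0) (ger0_norm bs0).
  apply: (@le_lt_trans _ _ (s * `|u| + s * `|v|)).
    by apply: lerD; rewrite ler_wpM2r // ler_piMl // ltW.
  apply: (@lt_le_trans _ _ (s * c)).
    by rewrite /c !mulrDr mulr1 ltrDl.
  have -> : s * c = d / 2 by rewrite /s divfK // gt_eqF.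
  by rewrite ler_pdivrMr // ler_peMr ?ler1n // ltW.
have HU a b : 0 <= a <= 1 -> 0 <= b <= 1 -> U (x + (a * s) *: u + (b * s) *: v).
  by move=> a01 b01; have [] := B _ (inB a b a01 b01).
have HU' a b : 0 <= a <= 1 -> 0 <= b <= 1 -> U (x + (a * s) *: v + (b * s) *: u).
  by move=> a01 b01; rewrite addrAC; exact: HU.
have [a [b [a01 b01 E1]]] := second_difference_mvt cf HU.
have [a' [b' [a01' b01' E2]]] := second_difference_mvt cf HU'.
have E : 'D_v ('D_u f) (x + (a * s) *: u + (b * s) *: v) =
         'D_u ('D_v f) (x + (a' * s) *: v + (b' * s) *: u).
  rewrite [x + s *: v + s *: u]addrAC in E2.
  apply: (mulIf (lt0r_neq0 s0)); apply: (mulIf (lt0r_neq0 s0)).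
  exact: (etrans (esym E1) (etrans (congr1 (+%R^~ (f x)) (addrAC _ _ _)) E2)).
have [_ B1 _] := B _ (inB a b a01 b01).
have := inB b' a' b01' a01'; rewrite addrAC => /B[_ _ B2].
exact: dist_le_common E B1 B2.
Qed.

Lemma Cinfty_derive (R : realType) (V W : normedModType R) (U : set V)
  (f : V -> W) v : Cinfty U f -> Cinfty U ('D_v f).
Proof. by move=> cf k; exact: (cf k.+1).2. Qed.

Lemma Cinfty_differentiable (R : realType) (V W : normedModType R) (U : set V)
  (f : V -> W) x : Cinfty U f -> U x -> differentiable f x.
Proof. by move=> cf; exact: (cf 1%N).1. Qed.

Lemma derive_swap_row (R : realType) (V : normedModType R) m
    (f : V -> 'rV[R]_m) (U : set V) (x u v : V) : open U -> Cinfty U f -> U x ->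
  'D_v ('D_u f) x = 'D_u ('D_v f) x.
Proof.
move=> oU cf Ux; apply/rowP => i.
have ci : Ck 2 U (fun y => f y ord0 i) by exact: (Ck_rowP _ _ oU).1 (cf 2%N) i.
have H u' v' : 'D_v' ('D_u' f) x ord0 i = 'D_v' ('D_u' (fun y => f y ord0 i)) x.
  rewrite derive_coord; last exact: Cinfty_differentiable (Cinfty_derive u' cf) Ux.
  apply: near_eq_derive; apply: filterS (open_nbhs_nbhs (conj oU Ux)) => y Uy.
  by rewrite derive_coord //; exact: Cinfty_differentiable cf Uy.
exact: etrans (H u v) (etrans (derive_swap u v oU ci Ux) (esym (H v u))).
Qed.

Lemma derive_swap3 (R : realType) (V : normedModType R) m
    (f : V -> 'rV[R]_m) (U : set V) (x u v w : V) : open U -> Cinfty U f -> U x ->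
  'D_w ('D_u ('D_v f)) x = 'D_v ('D_u ('D_w f)) x.
Proof.
move=> oU cf Ux.
apply: etrans (derive_swap_row u w oU (Cinfty_derive v cf) Ux) _.
apply: etrans (esym (derive_swap_row u v oU (Cinfty_derive w cf) Ux)).
apply: near_eq_derive; apply: filterS (open_nbhs_nbhs (conj oU Ux)) => y Uy.
exact: derive_swap_row oU cf Uy.
Qed.

(** The difference of the two forms is symmetric in its first two arguments and antisymmetric in its
    last two, hence zero: the algebra behind the uniqueness of the Levi-Civita connection. *)
Lemma koszul (R : realType) (T : Type) (C1 C2 : T -> T -> T -> R) :
  (forall a b c, C1 a b c = C1 b a c) -> (forall a b c, C2 a b c = C2 b a c) ->
  (forall a b c, C1 a b c + C1 a c b = C2 a b c + C2 a c b) ->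
  forall a b c, C1 a b c = C2 a b c.
Proof.
move=> s1 s2 E u v w; have Euv := E u v w; have Evu := E v u w; have Ew := E w u v.
rewrite (s1 v u) (s2 v u) in Evu; rewrite (s1 w u) (s1 w v) (s2 w u) (s2 w v) in Ew.
lra.
Qed.

Lemma cancel_common (R : realType) (p1 p2 q1 q2 a1 a2 b1 b2 : R) :
  p1 = q1 -> p2 = q2 -> p1 + a1 = p2 + a2 -> q1 + b1 = q2 + b2 ->
  a1 - b1 = a2 - b2.
Proof. lra. Qed.

Section gauss.
Context (R : realType) (V : normedModType R) (m1 m2 : nat) (U : set V).
Context (f1 : V -> 'rV[R]_m1) (f2 : V -> 'rV[R]_m2).
Hypothesis (oU : open U) (c1 : Cinfty U f1) (c2 : Cinfty U f2).
Hypothesis same_metric : forall x u v, U x ->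
  dot ('D_u f1 x) ('D_v f1 x) = dot ('D_u f2 x) ('D_v f2 x).

Lemma derive_dot_derive m (f : V -> 'rV[R]_m) (g : V -> 'rV[R]_m) x w :
  Cinfty U f -> Cinfty U g -> U x ->
  'D_w (fun y => dot (f y) (g y)) x =
  dot ('D_w f x) (g x) + dot (f x) ('D_w g x).
Proof.
by move=> cf cg Ux; rewrite derive_dot //; apply: Cinfty_differentiable Ux.
Qed.

(** With C a b c = <f_ab, f_c>, the derivative of <f_b, f_c> along a is C a b c + C a c b, which the
    metric alone determines; [koszul] then separates the two terms. *)
Lemma same_christoffel x u v w : U x ->
  dot ('D_u ('D_v f1) x) ('D_w f1 x) = dot ('D_u ('D_v f2) x) ('D_w f2 x).
Proof.
move=> Ux; move: u v w; apply: koszul => a b c.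
- exact: (congr1 (fun t => dot t ('D_c f1 x)) (derive_swap_row b a oU c1 Ux)).
- exact: (congr1 (fun t => dot t ('D_c f2 x)) (derive_swap_row b a oU c2 Ux)).
apply: etrans (f_equal2 +%R erefl (dotC _ _)) _.
apply: etrans _ (f_equal2 +%R erefl (dotC ('D_b f2 x) ('D_a ('D_c f2) x))).
apply: etrans (esym (derive_dot_derive a (Cinfty_derive b c1) (Cinfty_derive c c1) Ux)) _.
apply: etrans _ (derive_dot_derive a (Cinfty_derive b c2) (Cinfty_derive c c2) Ux).
apply: near_eq_derive; apply: filterS (open_nbhs_nbhs (conj oU Ux)) => y Uy.
exact: same_metric.
Qed.

(* The third derivatives cancel in D_z <f_uv, f_w> - D_v <f_uz, f_w>. *)
Lemma gauss_equation x u v z w : U x ->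
  dot ('D_u ('D_v f1) x) ('D_z ('D_w f1) x) -
    dot ('D_u ('D_z f1) x) ('D_v ('D_w f1) x) =
  dot ('D_u ('D_v f2) x) ('D_z ('D_w f2) x) -
    dot ('D_u ('D_z f2) x) ('D_v ('D_w f2) x).
Proof.
move=> Ux.
have E a b c d : dot ('D_a ('D_b ('D_c f1)) x) ('D_d f1 x) +
    dot ('D_b ('D_c f1) x) ('D_a ('D_d f1) x) =
    dot ('D_a ('D_b ('D_c f2)) x) ('D_d f2 x) +
    dot ('D_b ('D_c f2) x) ('D_a ('D_d f2) x).
  apply: etrans (esym (derive_dot_derive a
    (Cinfty_derive b (Cinfty_derive c c1)) (Cinfty_derive d c1) Ux)) _.
  apply: etrans _ (derive_dot_derive a
    (Cinfty_derive b (Cinfty_derive c c2)) (Cinfty_derive d c2) Ux).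
  apply: near_eq_derive; apply: filterS (open_nbhs_nbhs (conj oU Ux)) => y Uy.
  exact: same_christoffel.
have Ez := E z u v w; have Ev := E v u z w.
have S1 : dot ('D_z ('D_u ('D_v f1)) x) ('D_w f1 x) =
    dot ('D_v ('D_u ('D_z f1)) x) ('D_w f1 x).
  exact: (congr1 (fun t => dot t ('D_w f1 x)) (derive_swap3 u v z oU c1 Ux)).
have S2 : dot ('D_z ('D_u ('D_v f2)) x) ('D_w f2 x) =
    dot ('D_v ('D_u ('D_z f2)) x) ('D_w f2 x).
  exact: (congr1 (fun t => dot t ('D_w f2 x)) (derive_swap3 u v z oU c2 Ux)).
exact: (cancel_common S1 S2 Ez Ev).
Qed.

End gauss.

(** * Nonexistence in codimension at most one *)

(** The kernel of T^T has dimension q - n <= 1, so a nonzero vector of it spans it. Below, the rows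
    of T are tangent and a, b are normal; q = n and q = n + 1 are covered together. *)
Lemma line_complement (R : realType) (q n : nat) (T : 'M[R]_(n, q))
    (a b : 'rV[R]_q) : (q <= n.+1)%N -> row_free T -> a != 0 ->
  a *m T^T = 0 -> b *m T^T = 0 -> exists c, b = c *: a.
Proof.
move=> qn /eqP fT a0 /eqP aT /eqP bT; rewrite -!sub_kermx in aT bT.
apply/sub_rVP; apply: submx_trans bT _.
have rk : (\rank (kermx T^T) <= 1)%N.
  by rewrite mxrank_ker mxrank_tr fT leq_subLR addn1.
have [ra e] := mxrank_leqif_sup aT.
by rewrite -e eqn_leq ra rank_rV a0.
Qed.

Lemma mulmx_tr_dot (R : realType) (q n : nat) (T : 'M[R]_(n, q))
    (a : 'rV[R]_q) : (forall i, dot a (row i T) = 0) -> a *m T^T = 0.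
Proof.
move=> aT; apply/rowP => i; rewrite mxE [RHS]mxE -[RHS](aT i).
by apply: eq_bigr => j _; rewrite !mxE.
Qed.

(* The index (b, i) stands for the i-th chosen direction tangent to L_0 if b is
   false, and tangent to the sphere if b is true. *)
Definition Lform (R : realType) (u v : bool * bool) : R :=
  [&& ~~ u.1, ~~ v.1 & u.2 == v.2]%:R.

Definition Sform (R : realType) (u v : bool * bool) : R :=
  [&& u.1, v.1 & u.2 == v.2]%:R.

(* Both sides of the identity are Laplace expansions of the 4 x 4 determinant
   of h, along the rows 1, 2 and along the rows 1, 3. *)
Lemma laplace_rows12_13 (R : realType) (c : R)
    (h11 h12 h13 h14 h21 h22 h23 h24 h31 h32 h33 h34 h41 h42 h43 h44 : R) :
  let M a b c' d := c * (a * d - b * c') in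
  M h11 h12 h21 h22 * M h33 h34 h43 h44 - M h11 h13 h21 h23 * M h32 h34 h42 h44
  + M h11 h14 h21 h24 * M h32 h33 h42 h43 + M h12 h13 h22 h23 * M h31 h34 h41 h44
  - M h12 h14 h22 h24 * M h31 h33 h41 h43 + M h13 h14 h23 h24 * M h31 h32 h41 h42
  = - (M h11 h12 h31 h32 * M h23 h24 h43 h44
  - M h11 h13 h31 h33 * M h22 h24 h42 h44 + M h11 h14 h31 h34 * M h22 h23 h42 h43
  + M h12 h13 h32 h33 * M h21 h24 h41 h44 - M h12 h14 h32 h34 * M h21 h23 h41 h43
  + M h13 h14 h33 h34 * M h21 h22 h41 h42).
Proof. by move=> M; rewrite /M; ring. Qed.

Lemma no_codim1_curvature (R : realType) (h : bool * bool -> bool * bool -> R)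
    (c k mu : R) : k != 0 -> mu != 0 -> (forall u v, h u v = h v u) ->
  (forall u v z w, c * (h u v * h z w - h u z * h v w) =
    (k ^+ 2 * (Lform R u v * Lform R z w) +
     (Lform R u v - mu * Sform R u v) * (Lform R z w - mu * Sform R z w)) -
    (k ^+ 2 * (Lform R u z * Lform R v w) +
     (Lform R u z - mu * Sform R u z) * (Lform R v w - mu * Sform R v w))) ->
  False.
Proof.
move=> k0 mu0 sh E.
pose M i j k' l := c * (h i k' * h j l - h i l * h j k').
pose K i j k' l : R := (k ^+ 2 * (Lform R i k' * Lform R l j) +
     (Lform R i k' - mu * Sform R i k') * (Lform R l j - mu * Sform R l j)) -
    (k ^+ 2 * (Lform R i l * Lform R k' j) +
     (Lform R i l - mu * Sform R i l) * (Lform R k' j - mu * Sform R k' j)).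
(* The hypothesis at (i, k', l, j); symmetry of h puts the factors in the order of a 2 x 2 minor. *)
have ME i j k' l : M i j k' l = K i j k' l.
  by rewrite /M (sh j l) (sh j k') E.
pose x1 := (false, false); pose x2 := (false, true).
pose x3 := (true, false); pose x4 := (true, true).
have D : M x1 x2 x1 x2 * M x3 x4 x3 x4 - M x1 x2 x1 x3 * M x3 x4 x2 x4
  + M x1 x2 x1 x4 * M x3 x4 x2 x3 + M x1 x2 x2 x3 * M x3 x4 x1 x4
  - M x1 x2 x2 x4 * M x3 x4 x1 x3 + M x1 x2 x3 x4 * M x3 x4 x1 x2
  = - (M x1 x3 x1 x2 * M x2 x4 x3 x4
  - M x1 x3 x1 x3 * M x2 x4 x2 x4 + M x1 x3 x1 x4 * M x2 x4 x2 x3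
  + M x1 x3 x2 x3 * M x2 x4 x1 x4 - M x1 x3 x2 x4 * M x2 x4 x1 x3
  + M x1 x3 x3 x4 * M x2 x4 x1 x2) by exact: laplace_rows12_13.
rewrite !ME /K /Lform /Sform /= !(mulr0, mul0r, mulr1, mul1r, subr0, addr0, add0r,
  sub0r, oppr0, mulrN, mulNr, opprK) in D.
(* On the left of D only the first product survives, giving (k^2 + 1) mu^2; on the right only the
   second, giving (- mu) (- mu). *)
have : k ^+ 2 * mu ^+ 2 = 0 by move: D; nra.
by move/eqP; rewrite mulf_eq0 !expf_eq0 /= (negbTE k0) (negbTE mu0).
Qed.

(** * Second derivatives of the embedding at a point over the origin *)

Section fN0_hessian.
Context (R : realType) (m : nat) (phi ps : R -> R).
Local Notation n := m.+4.
Hypothesis hphi : tangherlini_profile n phi.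
Hypothesis (cps : Cinfty setT ps) (eps : forall t, ps (- t) = ps t).
Hypothesis (dps : forall t,
  derive1 ps t = derive1 phi t * slope n (mass R n / phi t)).
Hypothesis (psE : forall t, 0 <= t -> psi phi t = ps t).

Let hn : (4 <= n)%N. Proof. by []. Qed.

Local Notation V := (N0_ambient R n).
Local Notation A := (sharp phi).
Local Notation mu := (mass R n).
Local Notation e0 := (delta_mx ord0 ord0 : 'rV[R]_m.+3).
Local Notation L1 := (@fst 'rV[R]_2 'rV[R]_m.+3).
Local Notation L2 := (@snd 'rV[R]_2 'rV[R]_m.+3).

Definition pole : V := (0, e0).

Lemma dot_delta q (i j : 'I_q) :
  dot (delta_mx ord0 i) (delta_mx ord0 j : 'rV[R]_q) = (i == j)%:R.
Proof.
rewrite /dot (bigD1 i) //= big1 => [|k ki].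
  by rewrite addr0 !mxE !eqxx mul1r.
by rewrite !mxE (negbTE ki) andbF mul0r.
Qed.

Lemma pole_N0 : N0 pole.
Proof. by rewrite /N0 /= dot_delta. Qed.

Lemma pole_tangent (u : V) : N0_tangent pole u <-> dot e0 u.2 = 0.
Proof. by []. Qed.

(** This number is psi''(0). Off 0 the factor t cancels from psi' = phi' slope(mu / phi), and
    continuity gives the value at 0, where A and mu / phi are both 1. *)
Lemma sharp_ps_at0 : sharp ps 0 = slope n 1.
Proof.
have dps0 : derive1 ps 0 = 0 by rewrite dps (dphi_at0 hphi) mul0r.
pose F t := sharp ps t - A t * slope n (mu / phi t).
have F0 : F 0 = 0.
  apply: continuous_eq_at0 => [|t t0].
    have oT := @openT R; apply: (@Ck_continuous R R R 0 setT) => //.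
    apply: CkD => //; first exact: sharp_Cinfty cps 0%N.
    apply: CkN => //; apply: CkM => //; first exact: sharp_phi_Cinfty hphi 0%N.
    apply: (@Ck_comp1 R R 0 _ [set x | 0 < x] (slope n)) => //.
    - by move=> x _ /=; exact: ratio_gt0 hn hphi x.
    - exact: ratio_Ck hn hphi 0%N.
    - exact: slope_Ck hn 0%N.
  apply: (mulfI t0); rewrite mulr0 mulrBr mulrA (sharpE _ dps0).
  by rewrite (sharp_phiE hphi) dps subrr.
move/eqP: F0; rewrite subr_eq0 => /eqP ->.
rewrite (sharp_phi_at0 hn hphi) mul1r (phi_at0 hphi) divff //.
by rewrite gt_eqF // (mass_gt0 R hn).
Qed.

Lemma sharp_ps_neq0 : sharp ps 0 != 0.
Proof. by rewrite sharp_ps_at0 gt_eqF // (slope_gt0 hn). Qed.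

Lemma derive_L1 (u x : V) : 'D_u L1 x = u.1.
Proof. by apply: derive_linear; exact: continuous_fst. Qed.

Lemma derive_L2 (u x : V) : 'D_u L2 x = u.2.
Proof. by apply: derive_linear; exact: continuous_snd. Qed.

Lemma differentiable_L1 (x : V) : differentiable L1 x.
Proof. exact/linear_differentiable/continuous_fst. Qed.

Lemma differentiable_L2 (x : V) : differentiable L2 x.
Proof. exact/linear_differentiable/continuous_snd. Qed.

Definition normalize_deriv (v : V) (x : V) : 'rV[R]_m.+3 :=
  (enorm x.2)^-1 *: v.2 - (dot x.2 v.2 / enorm x.2 ^+ 3) *: x.2.

(** The first derivative as a function of the base point, in a closed form valid near the pole, so
    that it can be differentiated once more. *)
Definition fN0_retract_deriv (v : V) (x : V) : 'rV[R]_(3 + n.-1) := row_mx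
  (row_mx (const_mx (sharp ps (enorm x.1) * dot x.1 v.1) : 'rV[R]_1)
          ((sharp A (enorm x.1) * dot x.1 v.1) *: x.1 + A (enorm x.1) *: v.1))
  ((A (enorm x.1) * dot x.1 v.1) *: normalize x.2 +
   phi (enorm x.1) *: normalize_deriv v x).

Lemma derive_fN0_retract (v x : V) : x.2 != 0 ->
  'D_v (fun x => @fN0 R n phi (retract x)) x = fN0_retract_deriv v x.
Proof.
move=> x0; have [dr Dr] := derive_retract v x0.
rewrite derive_comp //; last exact: fN0_differentiable hn hphi _.
by rewrite (fN0_derive hphi cps dps psE) Dr.
Qed.

Lemma enorm_e0 : enorm e0 = 1.
Proof. by rewrite /enorm dot_delta sqrtr1. Qed.

(** Tangency makes the derivative of |y| and the value of <y, v.2> vanish at the pole; only the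
    derivative of <y, v.2>, times - y, is left. This is the second fundamental form of the unit
    sphere. *)
Lemma derive_normalize_deriv (u v : V) :
  N0_tangent pole u -> N0_tangent pole v ->
  differentiable (normalize_deriv v) pole /\
  'D_u (normalize_deriv v) pole = - dot u.2 v.2 *: e0.
Proof.
move=> /pole_tangent eu /pole_tangent ev.
have dx := differentiable_L2 pole; have Dx := derive_L2 u pole.
have p0 : L2 pole != 0 by exact: N0_neq0 pole_N0.
have [de De] := derive_enorm u dx p0.
rewrite Dx /= eu mul0r in De.
have e1 := enorm_e0.
have en0 : enorm (L2 pole) != 0 by rewrite /= e1 oner_eq0.
have di : differentiable (fun x : V => (enorm x.2)^-1) pole.
  exact: (differentiableV de en0).
have Di : 'D_u (fun x : V => (enorm x.2)^-1) pole = 0.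
  by rewrite deriveV //; [rewrite De scaler0|exact: diff_derivable].
have dc : differentiable (fun _ : V => v.2) pole by exact: differentiable_cst.
have [d1 D1] := deriveZ_row u di dc.
have dd : differentiable (fun x : V => dot x.2 v.2) pole.
  exact: differentiable_dot.
have Dd : 'D_u (fun x : V => dot x.2 v.2) pole = dot u.2 v.2.
  by rewrite derive_dot // Dx derive_cst dot0r addr0.
have di3 : differentiable (fun x : V => (enorm x.2 ^+ 3)^-1) pole.
  apply: differentiableV; last by rewrite expf_neq0.
  have -> : (fun x : V => enorm x.2 ^+ 3) =
      (fun x : V => enorm x.2 * (enorm x.2 * enorm x.2)).
    by apply/funext => x; rewrite !exprS expr0 mulr1.
  exact: (differentiableM de (differentiableM de de)).
have dq : differentiable (fun x : V => dot x.2 v.2 / enorm x.2 ^+ 3) pole.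
  exact: (@differentiableM _ _ (fun x : V => dot x.2 v.2)
    (fun x : V => (enorm x.2 ^+ 3)^-1)).
have Dq : 'D_u (fun x : V => dot x.2 v.2 / enorm x.2 ^+ 3) pole = dot u.2 v.2.
  rewrite (@deriveM _ _ (fun x : V => dot x.2 v.2)
    (fun x : V => (enorm x.2 ^+ 3)^-1)); [|exact: diff_derivable..].
  by rewrite Dd /= ev scale0r add0r e1 expr1n invr1 scale1r.
have [d2 D2] := deriveZ_row u dq dx.
split; first exact: (differentiableB d1 d2).
rewrite /normalize_deriv deriveB; [|exact: diff_derivable..].
rewrite D1 D2 Di Dq Dx derive_cst /= ev mul0r !scale0r scaler0 !addr0.
by rewrite sub0r scaleNr.
Qed.

Lemma fN0_retract_deriv_pole (v : V) : N0_tangent pole v ->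
  fN0_retract_deriv v pole = row_mx (row_mx (0 : 'rV[R]_1) v.1) (mu *: v.2).
Proof.
move=> /pole_tangent ev; rewrite /fN0_retract_deriv /normalize_deriv /=.
rewrite dot0l !mulr0 !scale0r !add0r enorm0 enorm_e0 ev mul0r scale0r subr0.
by rewrite invr1 scale1r (sharp_phi_at0 hn hphi) scale1r (phi_at0 hphi).
Qed.

(** Radial factors have zero derivative at x = 0, their profiles being even, so only the factor <x,
    v.1> and the sphere term contribute. In the middle block <x, v.1> meets another factor x and
    disappears. *)
Lemma derive_fN0_retract_deriv (u v : V) :
  N0_tangent pole u -> N0_tangent pole v ->
  'D_u (fN0_retract_deriv v) pole = row_mx
    (row_mx (const_mx (sharp ps 0 * dot u.1 v.1) : 'rV[R]_1) 0)
    ((dot u.1 v.1 - mu * dot u.2 v.2) *: e0).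
Proof.
move=> Tu Tv; have [dn Dn] := derive_normalize_deriv Tu Tv.
have dx := differentiable_L1 pole; have Dx := derive_L1 u pole.
have rad (a : R -> R) : Cinfty setT a -> derive1 a 0 = 0 ->
    differentiable (fun p : V => a (enorm p.1)) pole /\
    'D_u (fun p : V => a (enorm p.1)) pole = 0.
  move=> ca ea.
  have [] := radial_differentiable (L := L1) pole u (@continuous_fst _ _ _) ca ea.
  by rewrite /= dot0l mulr0.
have sE (a : R -> R) : (forall t, derivable a t 1) -> (forall t, a (- t) = a t) ->
    forall t, sharp a (- t) = sharp a t by move=> da ea t; exact: sharp_even.
have cA := sharp_phi_Cinfty hphi; have eA := sharp_phi_even hphi.
have dA (t : R) : derivable A t 1 by exact: Cinfty_derivable.
have dp (t : R) : derivable ps t 1 by exact: Cinfty_derivable.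
have csA := sharp_Cinfty cA; have csp := sharp_Cinfty cps.
have z0 (a : R -> R) : Cinfty setT a -> (forall t, a (- t) = a t) -> derive1 a 0 = 0.
  by move=> ca ea; apply: even_derive10 => // t; exact: Cinfty_derivable.
have [d1 D1] := rad _ csp (z0 _ csp (sE _ dp eps)).
have [d2 D2] := rad _ csA (z0 _ csA (sE _ dA eA)).
have [d3 D3] := rad _ cA (z0 _ cA eA).
have [d4 D4] := rad _ (phi_Cinfty hphi) (dphi_at0 hphi).
have dv1 : differentiable (fun _ : V => v.1) pole by exact: differentiable_cst.
have dd : differentiable (fun x : V => dot x.1 v.1) pole.
  exact: (@differentiable_dot _ _ _ L1 (fun _ : V => v.1)).
have Dd : 'D_u (fun x : V => dot x.1 v.1) pole = dot u.1 v.1.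
  rewrite (@derive_dot _ _ _ L1 (fun _ : V => v.1)) //.
  by rewrite Dx derive_cst dot0r addr0.
have mul_dot (a : R -> R) : differentiable (fun p : V => a (enorm p.1)) pole ->
    differentiable (fun x : V => a (enorm x.1) * dot x.1 v.1) pole /\
    'D_u (fun x : V => a (enorm x.1) * dot x.1 v.1) pole = a 0 * dot u.1 v.1.
  move=> da; split.
    exact: (@differentiableM _ _ (fun p : V => a (enorm p.1))
      (fun x : V => dot x.1 v.1)).
  rewrite (@deriveM _ _ (fun p : V => a (enorm p.1)) (fun x : V => dot x.1 v.1));
    [|exact: diff_derivable..].
  by rewrite Dd /= dot0l scale0r addr0 enorm0.
have [f1 F1] := mul_dot _ d1; have [f2 F2] := mul_dot _ d2.
have [f3 F3] := mul_dot _ d3.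
have [g1 G1] := @derive_const_mx _ _ 1 _ _ u f1.
have [g2 G2] := deriveZ_row u f2 dx.
have [g3 G3] := deriveZ_row u d3 dv1.
have p0 : L2 pole != 0 by exact: N0_neq0 pole_N0.
have [dN _] := derive_normalize u (differentiable_L2 pole) p0.
have [g4 G4] := deriveZ_row u f3 dN.
have [g5 G5] := deriveZ_row u d4 dn.
have [k1 K1] := derive_row_mx u g1 (differentiableD g2 g3).
have [k2 K2] := derive_row_mx u k1 (differentiableD g4 g5).
rewrite [LHS]K2 K1 G1 F1.
rewrite deriveD; [|exact: diff_derivable..].
rewrite deriveD; [|exact: diff_derivable..].
rewrite G2 G3 G4 G5 F2 F3 D3 D4 Dn derive_cst /= dot0l enorm0.
rewrite !mulr0 !scale0r !scaler0 !addr0 add0r (sharp_phi_at0 hn hphi) mul1r.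
have -> : normalize e0 = e0 by rewrite /normalize enorm_e0 invr1 scale1r.
by rewrite (phi_at0 hphi) scalerA -scalerDl mulrN.
Qed.

End fN0_hessian.

Lemma derive_comp_retract_diff (R : realType) (n : nat) (W : normedModType R)
    (H : N0_ambient R n -> W) x w : x.2 != 0 -> differentiable H (retract x) ->
  'D_w (fun y => H (retract y)) x = 'd H (retract x) ('D_w (@retract R n) x).
Proof.
move=> x0 dH; have [dr _] := derive_retract w x0.
by rewrite derive_comp // derive_diffE.
Qed.

Section codim1.
Context (R : realType) (m q : nat) (phi : R -> R).
Local Notation n := m.+4.
Hypothesis hphi : tangherlini_profile n phi.

Let hn : (4 <= n)%N. Proof. by []. Qed.

Local Notation V := (N0_ambient R n).
Local Notation mu := (mass R n).
Local Notation pole := (pole R m).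
Local Notation f2 := (fun x : V => @fN0 R n phi (retract x)).

(** The pole has y = e_0, so index 0 is skipped in the sphere directions; two others exist because
    the sphere has dimension n - 2 >= 2. *)
Definition frame (e : bool * bool) : V :=
  if e.1 then (0, delta_mx ord0 (if e.2 then lift ord0 (lift ord0 ord0)
                                 else lift ord0 ord0))
  else (delta_mx ord0 (if e.2 then lift ord0 ord0 else ord0), 0).

Lemma frame_tangent e : N0_tangent pole (frame e).
Proof. by case: e => -[] [] /=; rewrite /N0_tangent /= ?dot0r ?dot_delta. Qed.

Lemma frame_dot1 u v : dot (frame u).1 (frame v).1 = Lform R u v.
Proof.
by case: u v => -[] [] [[] []]; rewrite /Lform /= ?dot0l ?dot0r ?dot_delta.
Qed.

Lemma frame_dot2 u v : dot (frame u).2 (frame v).2 = Sform R u v.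
Proof.
by case: u v => -[] [] [[] []]; rewrite /Sform /= ?dot0l ?dot0r ?dot_delta.
Qed.

(** Linear coordinates on the tangent space at the pole: a differential restricted to that space
    becomes a matrix with n rows. *)
Definition tangent_coord (z : 'rV[R]_(2 + m.+2)) : V :=
  (lsubmx z, insert ord0 0 (rsubmx z)).

Lemma tangent_coord_is_linear : linear tangent_coord.
Proof.
move=> a u v; rewrite /tangent_coord !linearP; congr pair.
by apply/rowP => i; rewrite !mxE; case: unlift => [k|]; rewrite ?mulr0 ?addr0 ?mxE.
Qed.

HB.instance Definition _ := GRing.isLinear.Build R _ _ _ tangent_coord
  tangent_coord_is_linear.

Lemma tangent_coord_tangent z : N0_tangent pole (tangent_coord z).
Proof.
rewrite /N0_tangent /= /dot big_ord_recl /= insert_same mulr0 add0r.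
by rewrite big1 // => i _; rewrite !mxE /= mul0r.
Qed.

Lemma tangent_coord_inj z : tangent_coord z = 0 -> z = 0.
Proof.
move=> [E1 E2]; rewrite -[z]hsubmxK E1 -[RHS](@row_mx0 R 1 2 m.+2).
have -> : rsubmx z = 0; last by [].
apply/rowP => i; move/rowP: E2 => /(_ (lift ord0 i)).
by rewrite insert_lift => ->; rewrite !mxE.
Qed.

Lemma fN0_retract_Cinfty : Cinfty [set x : V | x.2 != 0] f2.
Proof.
move=> k; have cf := Ck_retract_comp (@openT V) (fN0_smooth hn hphi k).
by apply: sub_Ck cf => x.
Qed.

Lemma fN0_hessian (ps : R -> R) u v :
  Cinfty setT ps -> (forall t, ps (- t) = ps t) ->
  (forall t, derive1 ps t = derive1 phi t * slope n (mu / phi t)) ->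
  (forall t, 0 <= t -> psi phi t = ps t) ->
  'D_(frame u) ('D_(frame v) f2) pole = row_mx
    (row_mx (const_mx (sharp ps 0 * Lform R u v) : 'rV[R]_1) 0)
    ((Lform R u v - mu * Sform R u v) *: delta_mx ord0 ord0).
Proof.
move=> cps eps dps psE.
rewrite -frame_dot1 -frame_dot2.
rewrite -(derive_fN0_retract_deriv hphi cps eps (frame_tangent u) (frame_tangent v)).
apply: near_eq_derive.
have near_neq0 : \forall x \near pole, x.2 != 0.
  apply: (@open_nbhs_nbhs _ pole [set x : V | x.2 != 0]).
  by split; [exact: open_neq0_snd|exact: N0_neq0 (pole_N0 R m)].
apply: filterS near_neq0 => x x0.
exact: derive_fN0_retract hphi cps dps psE _ _ x0.
Qed.

Lemma fN0_hessian_dot (ps : R -> R) u v z w :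
  Cinfty setT ps -> (forall t, ps (- t) = ps t) ->
  (forall t, derive1 ps t = derive1 phi t * slope n (mu / phi t)) ->
  (forall t, 0 <= t -> psi phi t = ps t) ->
  dot ('D_(frame u) ('D_(frame v) f2) pole) ('D_(frame z) ('D_(frame w) f2) pole)
  = sharp ps 0 ^+ 2 * (Lform R u v * Lform R z w) +
    (Lform R u v - mu * Sform R u v) * (Lform R z w - mu * Sform R z w).
Proof.
move=> cps eps dps psE.
apply: etrans (f_equal2 (@dot R _) (fN0_hessian u v cps eps dps psE)
  (fN0_hessian z w cps eps dps psE)) _.
rewrite (@dot_row R 3 n.-1) (@dot_row R 1 2) dot_const1 dot0l addr0.
have e1 : dot (delta_mx ord0 ord0 : 'rV[R]_n.-1) (delta_mx ord0 ord0) = 1.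
  exact: pole_N0.
by rewrite dotZl dotZr e1 mulr1 mulrACA -expr2.
Qed.

Lemma derive_fN0_retract_pole (w : V) : N0_tangent pole w ->
  'D_w f2 pole = 'd (@fN0 R n phi) pole w.
Proof.
move=> Tw; apply: derive_comp_retract => //; first exact: pole_N0.
exact: fN0_differentiable hn hphi _.
Qed.

(** The second derivatives lie in the span of the psi-axis and of e_0 in the last block, both
    orthogonal to the tangent space of the image. *)
Lemma fN0_hessian_normal u v (w : V) : N0_tangent pole w ->
  dot ('D_(frame u) ('D_(frame v) f2) pole) ('D_w f2 pole) = 0.
Proof.
have [ps [cps eps dps psE]] := psi_smooth hn hphi.
move=> Tw; rewrite (fN0_hessian _ _ cps eps dps psE).
have p0 : pole.2 != 0 by exact: N0_neq0 (pole_N0 R m).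
rewrite (derive_fN0_retract hphi cps dps psE _ p0).
rewrite (fN0_retract_deriv_pole _ hphi Tw).
rewrite (@dot_row R 3 n.-1) (@dot_row R 1 2) dot0r dot0l add0r.
by rewrite dotZl dotZr (Tw : dot _ _ = 0) !mulr0 addr0.
Qed.

Lemma no_isometric_embedding : (q <= n.+1)%N ->
  ~ (exists F : V -> 'rV[R]_q,
       isometric_embedding (@N0 R n) (@N0_tangent R n) (gN0 phi) F).
Proof.
move=> qn [F [[sF _ _] iF]]; have Np := pole_N0 R m.
have [ps [cps eps dps psE]] := psi_smooth hn hphi.
have [U [G [oU Up cG GF]]] := sF _ Np.
pose D := [set x : V | x.2 != 0 /\ U (retract x)].
have oD : open D by exact: open_retract_preimage.
have Dp : D pole by split; [exact: N0_neq0|rewrite retract_id].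
pose f1 x := G (retract x).
have c1 : Cinfty D f1 by move=> k; exact: Ck_retract_comp.
have c2 : Cinfty D f2 by move=> k; apply: sub_Ck (fN0_retract_Cinfty k) => x [].
have same x u v : D x -> dot ('D_u f1 x) ('D_v f1 x) = dot ('D_u f2 x) ('D_v f2 x).
  move=> [x0 Ux]; have [dr _] := derive_retract 0 x0.
  have Nx := retract_N0 x0.
  have Tx w := derive_retract_tangent w x0.
  have dG : differentiable G (retract x) by exact: Cinfty_differentiable cG Ux.
  have df := fN0_differentiable hn hphi (retract x).
  have E1 w : 'D_w f1 x = 'd G (retract x) ('D_w (@retract R n) x).
    exact: derive_comp_retract_diff.
  have E2 w : 'D_w f2 x = 'd (@fN0 R n phi) (retract x) ('D_w (@retract R n) x).
    exact: (derive_comp_retract_diff (H := @fN0 R n phi)).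
  apply: etrans (f_equal2 (@dot R q) (E1 u) (E1 v)) _.
  apply: etrans _ (esym (f_equal2 (@dot R _) (E2 u) (E2 v))).
  (* G extends F near every point of [N0] in U, so the isometry condition is available at
     [retract x] and not just at the pole. *)
  apply: etrans (iF _ U G Nx (And4 oU Ux cG GF) _ _ (Tx u) (Tx v)) _.
  exact: esym (fN0_diff_isometry hn hphi Nx (Tx u) (Tx v)).
have d1 : differentiable f1 pole by exact: Cinfty_differentiable c1 Dp.
(* The rows of T span the tangent space of the hypothetical image; they are independent because the
   common metric transfers injectivity from the known embedding. *)
pose T := lin1_mx ('d f1 pole \o tangent_coord).
have TE z : z *m T = 'D_(tangent_coord z) f1 pole.
  by rewrite mul_rV_lin1 /= derive_diffE.
have fT : row_free T.
  apply: inj_row_free => z; rewrite TE => z0; apply: tangent_coord_inj.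
  have Tz := tangent_coord_tangent z.
  apply: (fN0_immersion hn hphi Np Tz); rewrite -derive_fN0_retract_pole //.
  by apply/eqP; rewrite -dot_eq0 -same // z0 dot0l.
pose al u v := 'D_(frame u) ('D_(frame v) f1) pole.
have alT u v : al u v *m T^T = 0.
  apply: mulmx_tr_dot => i; rewrite rowE TE.
  apply: etrans (same_christoffel oD c1 c2 same _ _ _ Dp) _.
  exact/fN0_hessian_normal/tangent_coord_tangent.
have gauss u v z w : dot (al u v) (al z w) - dot (al u z) (al v w) =
    (sharp ps 0 ^+ 2 * (Lform R u v * Lform R z w) +
     (Lform R u v - mu * Sform R u v) * (Lform R z w - mu * Sform R z w)) -
    (sharp ps 0 ^+ 2 * (Lform R u z * Lform R v w) +
     (Lform R u z - mu * Sform R u z) * (Lform R v w - mu * Sform R v w)).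
  apply: etrans (gauss_equation oD c1 c2 same _ _ _ _ Dp) _.
  exact: (f_equal2 (fun x y => x - y) (fN0_hessian_dot u v z w cps eps dps psE)
    (fN0_hessian_dot u z v w cps eps dps psE)).
pose a := al (false, false) (false, false).
(* If f_11 vanished, the Gauss equation for the two directions of L_0 would give - |f_12|^2 =
   psi''(0)^2 + 1 > 0. *)
have a0 : a != 0.
  apply/eqP => aE; have := gauss (false, false) (false, false) (false, true) (false, true).
  rewrite -/a aE dot0l sub0r /Lform /Sform /= !mulr0 !subr0 !mulr1 => E.
  have := dot_ge0 (al (false, false) (false, true)).
  rewrite -oppr_le0 E; apply/negP; rewrite -ltNge.
  by rewrite mul0r addr0 subr0 ltr_wpDl // sqr_ge0.
(* The vector a serves as the normal N; it is not normalized, and [dot a a] is the factor c of the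
   determinant identity. *)
pose h u v := dot (al u v) a / dot a a.
have aa0 : dot a a != 0 by rewrite dot_eq0.
have alE u v : al u v = h u v *: a.
  have [c E] := line_complement qn fT a0 (alT _ _) (alT u v).
  by rewrite /h E dotZl mulfK.
apply: (@no_codim1_curvature R h (dot a a) (sharp ps 0) mu).
- exact: sharp_ps_neq0 hphi cps dps.
- by rewrite gt_eqF // (mass_gt0 R hn).
- move=> u v; exact: (congr1 (fun t => dot t a / dot a a)
    (derive_swap_row (frame v) (frame u) oD c1 Dp)).
- have dE u v z w : h u v * (h z w * dot a a) = dot (al u v) (al z w).
    apply: etrans _ (esym (f_equal2 (@dot R q) (alE u v) (alE z w))).
    by rewrite dotZl dotZr.
  move=> u v z w; apply: etrans _ (gauss u v z w).
  apply: etrans _ (f_equal2 (fun x y => x - y) (dE u v z w) (dE u z v w)).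
  by move: (h u v) (h z w) (h u z) (h v w) (dot a a) => ? ? ? ? ?; clear; ring.
Qed.

End codim1.

Theorem proposition2p3 (R : realType) (n : nat) (phi : R -> R)
    (hn : (4 <= n)%N) (hphi : tangherlini_profile n phi) :
  [/\ isometric_embedding (@N0 R n) (@N0_tangent R n) (gN0 phi) (fN0 phi),
      submanifold n (fN0 phi @` @N0 R n),
      ~ (exists F : N0_ambient R n -> 'rV[R]_n,
           isometric_embedding (@N0 R n) (@N0_tangent R n) (gN0 phi) F) &
      ~ (exists F : N0_ambient R n -> 'rV[R]_(n.+1),
           isometric_embedding (@N0 R n) (@N0_tangent R n) (gN0 phi) F)].
Proof.
case: n hn hphi => [//|[//|[//|[//|m]]]] hn hphi; split.
- exact: fN0_isometric_embedding.
- exact: fN0_image_submanifold.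
- exact: no_isometric_embedding.
- exact: no_isometric_embedding.
Qed.
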